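(* Let $A$ be a Noetherian integral domain and $M$ a finitely generated multigraded $A[\mathbf x]$-module that is projective as an $A$-module. Let $\operatorname{rdim}_A(M)=r$ and let $\underline f=(f_0,\dots,f_r)$ be a filter-regular sequence for $M$ in $A[\mathbf x]$. Then there is $\nu_0\in\mathbb N^q$ such that $$\operatorname{div}_A\big((M/(\underline f)M)_\nu\big)=\operatorname{div}_A\big((M/(\underline f)M)_{\nu_0}\big)\neq 0$$ for every $\nu\ge\nu_0$.
   Context: Rings are commutative with $1$. Fix $q\ge1$, $n_1,\dots,n_q\ge1$, variables $\mathbf x=(x_{p,i})_{1\le p\le q,0\le i\le n_p}$; $A[\mathbf x]$ is $\mathbb N^q$-graded with coefficients in multidegree $0$ and $x_{p,i}$ of multidegree $\mathbf e_p$ (canonical basis vector). Multigraded modules are graded by $\mathbb N^q$, which is ordered componentwise; ''for $d$ large enough'' means for all $d\ge d_0$, some $d_0\in\mathbb N^q$. A multigraded module is eventually zero if its component of multidegree $d$ vanishes for $d$ large enough. A multihomogeneous $f\in A[\mathbf x]$ is filter-regular for $M$ if $(0:_Mf)=\{m\in M:fm=0\}$ is eventually zero; $(f_0,\dots,f_r)$ is a filter-regular sequence for $M$ if all $f_i$ are multihomogeneous and $f_i$ is filter-regular for $M/(f_0,\dots,f_{i-1})M$ for $i=0,\dots,r$. $\operatorname{rdim}_A(M)$: with $K$ the fraction field of $A$, there is a unique $H_M\in\mathbb Q[t_1,\dots,t_q]$ with $H_M(d)=\dim_K(M_d\otimes_AK)$ for $d$ large enough; $\operatorname{rdim}_A(M)$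 is its total degree ($-1$ if $H_M=0$). Divisors: a finitely generated $A$-module $N$ is torsion if $\operatorname{Ann}_A(N)\ne0$. Then for each height-one prime $\mathfrak p$ of $A$ the localization $N_{\mathfrak p}$ has finite length $\ell(N_{\mathfrak p})$ over $A_{\mathfrak p}$, and $\operatorname{div}_A(N)=\sum_{\mathfrak p}\ell(N_{\mathfrak p})[\mathfrak p]$, in the free abelian group on the height-one primes of $A$. If $N$ is not torsion, one sets $\operatorname{div}_A(N)=0$.
   Formalization: ''≠ 0'' is read as ''(M/(f)M)_ν is torsion'': the 0 set for non-torsion modules is kept distinct from the zero divisor, since literally the claim fails (A=Z, M=Z[x_0,x_1], f=(x_0,x_1) has zero divisor in all large degrees). *)

(* Defs.v *)
From HB Require Import structures.
From mathcomp Require Import all_boot all_order all_algebra.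
From mathcomp Require Import boolp classical_sets fsbigop.
From mathcomp Require Import freeg mpoly ring.

Set Implicit Arguments.
Unset Strict Implicit.
Unset Printing Implicit Defensive.

Import GRing.Theory.
Local Open Scope ring_scope.
Local Open Scope quotient_scope.

Local Notation "x %:F" := (tofrac x).

Record submod (R : nzRingType) (V : lmodType R) := Submod {
  submod_pred :> V -> Prop;
  submod0 : submod_pred 0;
  submodD : forall x y, submod_pred x -> submod_pred y -> submod_pred (x + y);
  submodZ : forall a x, submod_pred x -> submod_pred (a *: x) }.

Section Submodules.
Variables (R : nzRingType) (V : lmodType R).
Implicit Types U W : submod V.

Lemma submodN U x : U x -> U (- x).
Proof. by move=> Ux; rewrite -scaleN1r; apply: submodZ. Qed.

Lemma submodB U x y : U x -> U y -> U (x - y).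
Proof. by move=> Ux Uy; apply: submodD => //; apply: submodN. Qed.

Definition submod_lt U W : Prop :=
  (forall x, U x -> W x) /\ exists x, W x /\ ~ U x.

Section GenSubmod.
Variable S : V -> Prop.

Definition gen_submod_pred (x : V) : Prop :=
  forall U : submod V, (forall y, S y -> U y) -> U x.

Fact gen_submod0 : gen_submod_pred 0.
Proof. by move=> U _; apply: submod0. Qed.
Fact gen_submodD x y :
  gen_submod_pred x -> gen_submod_pred y -> gen_submod_pred (x + y).
Proof. by move=> Px Py U SU; apply: submodD; [apply: Px|apply: Py]. Qed.
Fact gen_submodZ a x : gen_submod_pred x -> gen_submod_pred (a *: x).
Proof. by move=> Px U SU; apply: submodZ; apply: Px. Qed.

Definition gen_submod : submod V := Submod gen_submod0 gen_submodD gen_submodZ.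

End GenSubmod.

Definition span (s : seq V) (x : V) : Prop :=
  exists c : nat -> R, x = \sum_(i < size s) c i *: s`_i.

Definition fin_gen_submod U : Prop :=
  exists s : seq V, forall x, U x <-> span s x.

End Submodules.

Section SubType.
Variables (R : nzRingType) (V : lmodType R) (U : submod V).

Definition in_submod : {pred V} := fun x => `[< U x >].

Lemma in_submod_closed : submod_closed in_submod.
Proof.
split=> [|a x y]; first by apply/asboolP/submod0.
move=> /asboolP Ux /asboolP Uy.
by apply/asboolP/submodD => //; apply: submodZ.
Qed.

HB.instance Definition _ :=
  GRing.isSubmodClosed.Build R V in_submod in_submod_closed.

Definition submod_type := {x : V | x \in in_submod}.

HB.instance Definition _ := SubChoice.on submod_type.
HB.instance Definition _ := [SubChoice_isSubLmodule of submod_type by <:].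

End SubType.

Section Quotient.
Variables (R : nzRingType) (V : lmodType R) (U : submod V).

Definition qrel (x y : V) : bool := `[< U (x - y) >].

Lemma qrel_equiv : equiv_class_of qrel.
Proof.
split=> [x|x y|y x z]; rewrite /qrel.
- by apply/asboolP; rewrite subrr; apply: submod0.
- by apply/asboolP/asboolP => /submodN; rewrite opprB.
- move=> /asboolP Uxy /asboolP Uyz; apply/asboolP.
  by rewrite -(subrKA y); apply: submodD.
Qed.

Canonical qrel_equivRel := EquivRelPack qrel_equiv.

Definition quot_type := {eq_quot qrel_equivRel}.

HB.instance Definition _ := Choice.on quot_type.
HB.instance Definition _ : EqQuotient V qrel_equivRel quot_type :=
  EqQuotient.on quot_type.

Definition qpi (x : V) : quot_type := \pi_quot_type x.

Lemma qpiP x y : qpi x = qpi y <-> U (x - y).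
Proof.
split=> [/eqquotP /asboolP //|Uxy].
by apply/eqquotP/asboolP.
Qed.

Lemma qpi_repr (x : quot_type) : qpi (repr x) = x.
Proof. exact: reprK. Qed.

Lemma qrepr_pi x : U (repr (qpi x) - x).
Proof. by apply/qpiP; rewrite qpi_repr. Qed.

Definition qadd (x y : quot_type) := qpi (repr x + repr y).
Definition qopp (x : quot_type) := qpi (- repr x).
Definition qscale (a : R) (x : quot_type) := qpi (a *: repr x).

Lemma qpiD x y : qadd (qpi x) (qpi y) = qpi (x + y).
Proof. by apply/qpiP; rewrite opprD addrACA; apply: submodD; apply: qrepr_pi. Qed.

Lemma qpiN x : qopp (qpi x) = qpi (- x).
Proof. by apply/qpiP; rewrite -opprD; apply/submodN/qrepr_pi. Qed.

Lemma qpiZ a x : qscale a (qpi x) = qpi (a *: x).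
Proof. by apply/qpiP; rewrite -scalerBr; apply/submodZ/qrepr_pi. Qed.

Lemma quot_ind (P : quot_type -> Prop) : (forall x, P (qpi x)) -> forall x, P x.
Proof. by move=> h x; rewrite -(qpi_repr x). Qed.

Fact qaddA : associative qadd.
Proof.
by elim/quot_ind=> x; elim/quot_ind=> y; elim/quot_ind=> z; rewrite !qpiD addrA.
Qed.
Fact qaddC : commutative qadd.
Proof. by elim/quot_ind=> x; elim/quot_ind=> y; rewrite !qpiD addrC. Qed.
Fact qadd0 : left_id (qpi 0) qadd.
Proof. by elim/quot_ind=> x; rewrite qpiD add0r. Qed.
Fact qaddN : left_inverse (qpi 0) qopp qadd.
Proof. by elim/quot_ind=> x; rewrite qpiN qpiD addNr. Qed.

HB.instance Definition _ := GRing.isZmodule.Build quot_type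
  qaddA qaddC qadd0 qaddN.

Fact qscaleA a b (x : quot_type) : qscale a (qscale b x) = qscale (a * b) x.
Proof. by elim/quot_ind: x => x; rewrite !qpiZ scalerA. Qed.
Fact qscale1 : left_id 1 qscale.
Proof. by elim/quot_ind=> x; rewrite qpiZ scale1r. Qed.
Fact qscaleDr : right_distributive qscale +%R.
Proof.
move=> a; elim/quot_ind=> x; elim/quot_ind=> y.
by rewrite [qpi x + qpi y]qpiD !qpiZ [RHS]qpiD scalerDr.
Qed.
Fact qscaleDl x : {morph qscale^~ x : a b / a + b}.
Proof.
move=> a b; elim/quot_ind: x => x.
by rewrite !qpiZ [RHS]qpiD scalerDl.
Qed.

HB.instance Definition _ := GRing.Zmodule_isLmodule.Build R quot_type
  qscaleA qscale1 qscaleDr qscaleDl.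

End Quotient.

Definition fin_gen (R : nzRingType) (V : lmodType R) : Prop :=
  exists s : seq V, forall x, span s x.

Definition noetherian (A : comNzRingType) : Prop :=
  forall I : submod A^o, fin_gen_submod I.

Definition projective (R : nzRingType) (V : lmodType R) : Prop :=
  forall (X Y : lmodType R) (g : {linear X -> Y}) (h : {linear V -> Y}),
    (forall y, exists x, g x = y) -> exists l : {linear V -> X}, g \o l =1 h.

Definition torsion (A : idomainType) (N : lmodType A) : Prop :=
  exists2 a : A, a != 0 & forall x : N, a *: x = 0.

Definition submod_chain (R : nzRingType) (V : lmodType R) (k : nat) : Prop :=
  exists c : nat -> submod V, forall i, (i < k)%N -> submod_lt (c i) (c i.+1).

(* The supremum of the lengths of the chains, 0 when it is infinite. *)
Definition mlength (R : nzRingType) (V : lmodType R) : nat :=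
  xget 0%N [set k | submod_chain V k /\ ~ submod_chain V k.+1]%classic.

Definition is_dim (K : fieldType) (V : lmodType K) (k : nat) : Prop :=
  exists b : 'I_k -> V, forall v,
    exists! c : {ffun 'I_k -> K}, v = \sum_i c i *: b i.

(* The tensor product of an A-module with the fraction field K of A:
    the free K-vector space on N modulo the relations that make
    x |-> <<x>> an A-linear map. *)

Section TensorFrac.
Variables (A : idomainType) (N : lmodType A).
Local Notation K := {fraction A}.

Definition tensor_rel (z : {freeg N / K}) : Prop :=
  exists (a : A) (x y : N),
    z = << a *: x + y >> - (a%:F *: << x >> + << y >>).

Definition tensor_frac : lmodType K := quot_type (gen_submod tensor_rel).

End TensorFrac.

Record primeid (A : idomainType) := PrimeId {
  primeid_ideal :> submod A^o;
  primeid_proper : ~ primeid_ideal 1;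
  primeidM : forall a b, primeid_ideal (a * b) ->
    primeid_ideal a \/ primeid_ideal b }.

HB.instance Definition _ A := gen_eqMixin (primeid A).
HB.instance Definition _ A := gen_choiceMixin (primeid A).

Definition prime_chain (A : idomainType) (p : primeid A) (k : nat) : Prop :=
  exists c : nat -> primeid A,
    c k = p /\ forall i, (i < k)%N -> submod_lt (c i) (c i.+1).

Definition height_eq (A : idomainType) (p : primeid A) (k : nat) : Prop :=
  prime_chain p k /\ ~ prime_chain p k.+1.

Definition ht1prime (A : idomainType) :=
  {p : primeid A | `[< height_eq p 1 >]}.

HB.instance Definition _ A := SubChoice.on (ht1prime A).

Section LocRing.
Variables (A : idomainType) (p : primeid A).

Lemma primeid1 : ~ p (1 : A). Proof. exact: primeid_proper. Qed.
Lemma primeidNM (a b : A) : ~ p a -> ~ p b -> ~ p (a * b).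
Proof. by move=> pa pb /primeidM[]. Qed.
Lemma primeidN_neq0 (a : A) : ~ p a -> a%:F != 0.
Proof.
by move=> pa; rewrite tofrac_eq0; apply: contra_notN pa => /eqP->; apply: submod0.
Qed.

Definition loc_pred : {pred {fraction A}} :=
  fun x => `[< exists a s : A, ~ p s /\ x = a%:F / s%:F >].

Lemma loc_pred_closed : subring_closed loc_pred.
Proof.
split=> [|x y|x y].
- apply/asboolP; exists 1, 1; split; first exact: primeid1.
  by rewrite divff // oner_eq0.
- move=> /asboolP[a [s [ps ->]]] /asboolP[b [t [pt ->]]]; apply/asboolP.
  exists (a * t - b * s), (s * t); split; first exact: primeidNM.
  by rewrite -mulNr addf_div ?primeidN_neq0 // rmorphB !rmorphM /= mulNr.
- move=> /asboolP[a [s [ps ->]]] /asboolP[b [t [pt ->]]]; apply/asboolP.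
  exists (a * b), (s * t); split; first exact: primeidNM.
  by rewrite mulf_div !rmorphM.
Qed.

HB.instance Definition _ :=
  GRing.isSubringClosed.Build {fraction A} loc_pred loc_pred_closed.

Definition loc_ring := {x : {fraction A} | x \in loc_pred}.

HB.instance Definition _ := SubChoice.on loc_ring.
HB.instance Definition _ := [SubChoice_isSubComNzRing of loc_ring by <:].

Lemma loc_ringP (x : loc_ring) :
  {as_ : A * A | ~ p as_.2 /\ val x = as_.1%:F / as_.2%:F}.
Proof.
apply: cid; case: x => x /= /asboolP[a [s h]].
by exists (a, s).
Qed.

Definition loc_num (x : loc_ring) : A := (sval (loc_ringP x)).1.
Definition loc_den (x : loc_ring) : A := (sval (loc_ringP x)).2.

Lemma loc_denP (x : loc_ring) : ~ p (loc_den x).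
Proof. by rewrite /loc_den; case: loc_ringP => ? []. Qed.

Arguments loc_denP x : clear implicits.

Lemma loc_numdenP (x : loc_ring) (a s : A) : ~ p s ->
  val x = a%:F / s%:F -> loc_num x * s = a * loc_den x.
Proof.
move=> ps; rewrite /loc_num /loc_den; case: loc_ringP => -[b t] /= [pt ->].
move/eqP; rewrite eqr_div ?primeidN_neq0 // -!rmorphM /=.
by rewrite tofrac_eq => /eqP.
Qed.

Lemma loc_numdenE (x : loc_ring) : val x = (loc_num x)%:F / (loc_den x)%:F.
Proof. by rewrite /loc_num /loc_den; case: loc_ringP => ? []. Qed.

End LocRing.

Arguments loc_denP {A p} x _.
Arguments primeid1 {A} p _.

Section LocModule.
Variables (A : idomainType) (p : primeid A) (N : lmodType A).

Definition loc_denom := {s : A | `[< ~ p s >]}.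

Definition loc_rel (u v : N * loc_denom) : bool :=
  `[< exists t : A, ~ p t /\ t *: (val v.2 *: u.1 - val u.2 *: v.1) = 0 >].

Lemma loc_denomP (s : loc_denom) : ~ p (val s).
Proof. by case: s => s /= /asboolP. Qed.
Arguments loc_denomP s : clear implicits.

Lemma loc_rel_equiv : equiv_class_of loc_rel.
Proof.
split=> [[x s]|[x s] [y t]|[y t] [x s] [z u]]; rewrite /loc_rel /=.
- by apply/asboolP; exists 1; split; [apply: primeid1|rewrite subrr scaler0].
- apply/asboolP/asboolP => -[w [pw h]]; exists w; split=> //;
  by rewrite -opprB scalerN h oppr0.
- move=> /asboolP[a [pa ha]] /asboolP[b [pb hb]]; apply/asboolP.
  exists (a * b * val t); split.
    by apply: primeidNM; [apply: primeidNM|apply: loc_denomP].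
  have -> : a * b * val t *: (val u *: x - val s *: z) =
      (b * val u) *: (a *: (val t *: x - val s *: y)) +
      (a * val s) *: (b *: (val u *: y - val t *: z)).
    rewrite !scalerBr !scalerA.
    rewrite (_ : b * val u * a * val s = a * val s * b * val u); last by ring.
    by rewrite addrA subrK; congr (_ *: _ - _ *: _); ring.
  by rewrite ha hb !scaler0 addr0.
Qed.

Canonical loc_rel_equivRel := EquivRelPack loc_rel_equiv.

Definition loc_mod := {eq_quot loc_rel_equivRel}.

HB.instance Definition _ := Choice.on loc_mod.
HB.instance Definition _ : EqQuotient (N * loc_denom)%type loc_rel_equivRel loc_mod :=
  EqQuotient.on loc_mod.

Definition lfrac (x : N) (s : loc_denom) : loc_mod := \pi_loc_mod (x, s).

Lemma lfracP x s y t : lfrac x s = lfrac y t <->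
  exists u : A, ~ p u /\ u *: (val t *: x - val s *: y) = 0.
Proof. by split=> [/eqquotP /asboolP|h]; [|apply/eqquotP/asboolP]. Qed.

Lemma loc_mod_ind (P : loc_mod -> Prop) :
  (forall x s, P (lfrac x s)) -> forall z, P z.
Proof. by move=> h z; rewrite -[z]reprK; case: (repr z). Qed.

Lemma lfrac_eq x s y t : val t *: x = val s *: y -> lfrac x s = lfrac y t.
Proof.
move=> e; apply/lfracP; exists 1.
by rewrite e subrr scaler0; split=> //; apply: primeid1.
Qed.

Lemma lfrac_repr x s : exists u : A,
  ~ p u /\ u *: (val s *: (repr (lfrac x s)).1 - val (repr (lfrac x s)).2 *: x) = 0.
Proof. by apply/lfracP; rewrite -[RHS]reprK /lfrac; case: (repr _). Qed.

Definition mkdenom (s : A) (ps : ~ p s) : loc_denom :=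
  exist _ s (asboolT ps).

Definition denomM (s t : loc_denom) : loc_denom :=
  mkdenom (primeidNM (loc_denomP s) (loc_denomP t)).

Definition ladd (z w : loc_mod) : loc_mod :=
  let: (x, s) := repr z in let: (y, t) := repr w in
  lfrac (val t *: x + val s *: y) (denomM s t).

Definition lopp (z : loc_mod) : loc_mod :=
  let: (x, s) := repr z in lfrac (- x) s.

Definition lscale (a : loc_ring p) (z : loc_mod) : loc_mod :=
  let: (x, s) := repr z in
  lfrac (loc_num a *: x) (denomM (mkdenom (loc_denP a)) s).

Lemma laddE x s y t :
  ladd (lfrac x s) (lfrac y t) = lfrac (val t *: x + val s *: y) (denomM s t).
Proof.
have [u [pu hu]] := lfrac_repr x s; have [v [pv hv]] := lfrac_repr y t.
rewrite /ladd; case: (repr (lfrac x s)) hu => x' s' /= hu.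
case: (repr (lfrac y t)) hv => y' t' /= hv.
apply/lfracP; exists (u * v); split; first exact: primeidNM.
have -> : (u * v) *: (val (denomM s t) *: (val t' *: x' + val s' *: y')
    - val (denomM s' t') *: (val t *: x + val s *: y)) =
  (v * val t * val t') *: (u *: (val s *: x' - val s' *: x)) +
  (u * val s * val s') *: (v *: (val t *: y' - val t' *: y)).
  rewrite /= !(scalerBr, scalerDr) !scalerA opprD addrACA.
  by congr (_ *: _ - _ *: _ + (_ *: _ - _ *: _)); ring.
by rewrite hu hv !scaler0 addr0.
Qed.

Lemma loppE x s : lopp (lfrac x s) = lfrac (- x) s.
Proof.
have [u [pu hu]] := lfrac_repr x s.
rewrite /lopp; case: (repr (lfrac x s)) hu => x' s' /= hu.
apply/lfracP; exists u; split=> //.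
by rewrite !scalerN -opprD scalerN hu oppr0.
Qed.

Lemma lscaleE a (b t : A) x s (pt : ~ p t) : val a = b%:F / t%:F ->
  lscale a (lfrac x s) = lfrac (b *: x) (denomM (mkdenom pt) s).
Proof.
move=> /(loc_numdenP pt) ab; have [u [pu hu]] := lfrac_repr x s.
rewrite /lscale; case: (repr (lfrac x s)) hu => x' s' /= hu.
apply/lfracP; exists u; split=> //=.
have -> : u *: ((t * val s) *: (loc_num a *: x')
                - (loc_den a * val s') *: (b *: x)) =
  (b * loc_den a) *: (u *: (val s *: x' - val s' *: x)).
  rewrite !scalerBr !scalerA -ab.
  congr (_ *: _ - _ *: _); first ring.
  by rewrite [in RHS]ab; ring.
by rewrite hu scaler0.
Qed.

Lemma lscale_numden a x s : lscale a (lfrac x s) =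
  lfrac (loc_num a *: x) (denomM (mkdenom (loc_denP a)) s).
Proof. exact/lscaleE/loc_numdenE. Qed.

Local Notation one_denom := (mkdenom (primeid1 p)).

Fact laddA : associative ladd.
Proof.
elim/loc_mod_ind=> x s; elim/loc_mod_ind=> y t; elim/loc_mod_ind=> z u.
rewrite !laddE; apply: lfrac_eq => /=.
rewrite !scalerDr !scalerA -!addrA.
by congr (_ *: _ + (_ *: _ + _ *: _)); ring.
Qed.

Fact laddC : commutative ladd.
Proof.
elim/loc_mod_ind=> x s; elim/loc_mod_ind=> y t.
rewrite !laddE; apply: lfrac_eq => /=.
by rewrite !scalerDr !scalerA addrC; congr (_ *: _ + _ *: _); ring.
Qed.

Fact ladd0 : left_id (lfrac 0 one_denom) ladd.
Proof.
elim/loc_mod_ind=> x s; rewrite laddE; apply: lfrac_eq => /=.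
by rewrite scaler0 add0r scale1r mul1r.
Qed.

Fact laddN : left_inverse (lfrac 0 one_denom) lopp ladd.
Proof.
elim/loc_mod_ind=> x s; rewrite loppE laddE; apply: lfrac_eq => /=.
by rewrite scalerN addNr !scaler0.
Qed.

HB.instance Definition _ := GRing.isZmodule.Build loc_mod
  laddA laddC ladd0 laddN.

Fact lscaleA a b z : lscale a (lscale b z) = lscale (a * b) z.
Proof.
elim/loc_mod_ind: z => x s.
rewrite [RHS](lscaleE _ _ (primeidNM (loc_denP a) (loc_denP b))
  (b := loc_num a * loc_num b)); last first.
  transitivity (val a * val b); first by [].
  rewrite (loc_numdenE a) (loc_numdenE b) mulf_div.
  by rewrite !rmorphM.
rewrite !lscale_numden; apply: lfrac_eq => /=.
by rewrite !scalerA; congr (_ *: _); ring.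
Qed.

Fact lscale1 : left_id 1 lscale.
Proof.
elim/loc_mod_ind=> x s.
rewrite (lscaleE _ _ (primeid1 p) (b := 1)); last by rewrite rmorph1 divr1.
by apply: lfrac_eq; rewrite /= scale1r mul1r.
Qed.

Fact lscaleDr : right_distributive lscale +%R.
Proof.
move=> a; elim/loc_mod_ind=> x s; elim/loc_mod_ind=> y t.
rewrite [lfrac x s + _]laddE !lscale_numden [RHS]laddE; apply: lfrac_eq => /=.
by rewrite !scalerDr !scalerA; congr (_ *: _ + _ *: _); ring.
Qed.

Fact lscaleDl z : {morph lscale^~ z : a b / a + b}.
Proof.
move=> a b; elim/loc_mod_ind: z => x s.
rewrite [LHS](lscaleE _ _ (primeidNM (loc_denP a) (loc_denP b))
  (b := loc_num a * loc_den b + loc_num b * loc_den a)); last first.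
  transitivity (val a + val b); first by [].
  rewrite (loc_numdenE a) (loc_numdenE b).
  by rewrite addf_div ?(primeidN_neq0 (loc_denP _)) // rmorphD !rmorphM.
rewrite !lscale_numden [RHS]laddE; apply: lfrac_eq => /=.
by rewrite !scalerDr !scalerA -scalerDl; congr (_ *: _); ring.
Qed.

HB.instance Definition _ := GRing.Zmodule_isLmodule.Build (loc_ring p) loc_mod
  lscaleA lscale1 lscaleDr lscaleDl.

End LocModule.

(* [None] is the value 0 of the divisor of a module that is not torsion. It is
   kept apart from [Some 0], the zero of the free abelian group, which is the
   divisor of every torsion module supported in codimension at least 2 (for
   instance of the zero module), exactly as div(0) is kept apart from the
   divisor of a unit. *)
Definition divisor (A : idomainType) := option {freeg (ht1prime A) / int}.

Definition div_zero (A : idomainType) : divisor A := None.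

(* The sum ranges over all height-one primes; [fsbigop] sums are restricted to
   the support when it is finite, as it is for N finitely generated over A
   Noetherian. *)
Definition div (A : idomainType) (N : lmodType A) : divisor A :=
  if pselect (torsion N) then
    Some (\sum_(p \in [set: ht1prime A])
            << (mlength (loc_mod (val p) N))%:Z *g p >>)
  else div_zero A.

(* The polynomial ring A[x] in the variables x_(p,i), p < q and i <= n p; they
   are numbered by blocks, the variable of index k being x_(p,i) for
   p = tagnat.sig1 k and i = tagnat.sig2 k. *)
Notation mring A n := {mpoly A[(\sum_p (n p).+1)%N]}.

Section Multidegree.
Variables (A : idomainType) (q : nat) (n : 'I_q -> nat).

Definition multideg (m : 'X_{1..(\sum_p (n p).+1)%N}) : 'X_{1..q} :=
  [multinom (\sum_(k | tagnat.sig1 k == p) m k)%N | p < q].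

Definition is_multihomog (f : mring A n) (d : 'X_{1..q}) : Prop :=
  forall m, m \in msupp f -> multideg m = d.

Definition multihomog (f : mring A n) : Prop := exists d, is_multihomog f d.

End Multidegree.

Section Restriction.
Variables (A : idomainType) (k : nat) (V : lmodType {mpoly A[k]}).

Definition restr : Type := V.

HB.instance Definition _ := GRing.Zmodule.on restr.

Definition restr_scale (a : A) (x : restr) : restr := a%:MP *: (x : V).

Fact restr_scaleA a b x :
  restr_scale a (restr_scale b x) = restr_scale (a * b) x.
Proof. by rewrite /restr_scale scalerA mpolyCM. Qed.
Fact restr_scale1 : left_id 1 restr_scale.
Proof. by move=> x; rewrite /restr_scale scale1r. Qed.
Fact restr_scaleDr : right_distributive restr_scale +%R.
Proof. by move=> a x y; rewrite /restr_scale scalerDr. Qed.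
Fact restr_scaleDl x : {morph restr_scale^~ x : a b / a + b}.
Proof. by move=> a b; rewrite /restr_scale mpolyCD scalerDl. Qed.

HB.instance Definition _ := GRing.Zmodule_isLmodule.Build A restr
  restr_scaleA restr_scale1 restr_scaleDr restr_scaleDl.

End Restriction.

(* An A[x]-module with a family of A-submodules indexed by N^q, meant to be the
   components of a grading, see [multigraded]. *)
Record mgmod (A : idomainType) (q : nat) (n : 'I_q -> nat) := Mgmod {
  mg_module :> lmodType (mring A n);
  mg_submod : 'X_{1..q} -> submod (restr mg_module) }.

Section Multigraded.
Variables (A : idomainType) (q : nat) (n : 'I_q -> nat).
Implicit Type M : mgmod A n.

Definition component M (d : 'X_{1..q}) : lmodType A :=
  submod_type (mg_submod M d).

Definition multigraded M : Prop :=
  [/\ forall x : M, exists (s : seq 'X_{1..q}) (c : 'X_{1..q} -> M),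
        (forall d, mg_submod M d (c d)) /\ x = \sum_(d <- s) c d,
      forall (s : seq 'X_{1..q}) (c : 'X_{1..q} -> M),
        uniq s -> (forall d, mg_submod M d (c d)) ->
        \sum_(d <- s) c d = 0 -> forall d, d \in s -> c d = 0 &
      forall (f : mring A n) (x : M) (d e : 'X_{1..q}),
        is_multihomog f e -> mg_submod M d x ->
        mg_submod M (e + d)%MM (f *: x)].

Section IdealMul.
Variables (M : mgmod A n) (s : seq (mring A n)).

Definition ideal_mul_pred (x : M) : Prop :=
  exists y : nat -> M, x = \sum_(i < size s) s`_i *: y i.

Fact ideal_mul0 : ideal_mul_pred 0.
Proof. by exists (fun=> 0); apply/esym/big1 => i _; rewrite scaler0. Qed.
Fact ideal_mulD x y :
  ideal_mul_pred x -> ideal_mul_pred y -> ideal_mul_pred (x + y).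
Proof.
move=> [u ->] [v ->]; exists (fun i => u i + v i).
by rewrite -big_split; apply: eq_bigr => i _; rewrite scalerDr.
Qed.
Fact ideal_mulZ a x : ideal_mul_pred x -> ideal_mul_pred (a *: x).
Proof.
move=> [u ->]; exists (fun i => a *: u i).
by rewrite scaler_sumr; apply: eq_bigr => i _; rewrite !scalerA mulrC.
Qed.

Definition ideal_mul : submod M := Submod ideal_mul0 ideal_mulD ideal_mulZ.

End IdealMul.

Section GradedQuotient.
Variables (M : mgmod A n) (U : submod M) (d : 'X_{1..q}).

Definition quot_comp_pred (z : restr (quot_type U)) : Prop :=
  exists x : M, mg_submod M d x /\ z = qpi U x.

Fact quot_comp0 : quot_comp_pred 0.
Proof. by exists 0; split=> //; apply: (submod0 (mg_submod M d)). Qed.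
Fact quot_compD z w :
  quot_comp_pred z -> quot_comp_pred w -> quot_comp_pred (z + w).
Proof.
move=> [x [Mx ->]] [y [My ->]]; exists (x + y); split; last exact: qpiD.
exact: (submodD (s := mg_submod M d)).
Qed.
Fact quot_compZ a z : quot_comp_pred z -> quot_comp_pred (a *: z).
Proof.
move=> [x [Mx ->]]; exists (a%:MP *: x); split; last exact: qpiZ.
exact: (submodZ (s := mg_submod M d)).
Qed.

Definition quot_comp : submod (restr (quot_type U)) :=
  Submod quot_comp0 quot_compD quot_compZ.

End GradedQuotient.

Definition mg_quot M (U : submod M) : mgmod A n :=
  @Mgmod A q n (quot_type U) (quot_comp U).

Definition eventually (P : 'X_{1..q} -> Prop) : Prop :=
  exists d0, forall d, (d0 <= d)%MM -> P d.

Definition filter_regular M (f : mring A n) : Prop :=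
  multihomog f /\
  eventually (fun d => forall x : M, mg_submod M d x -> f *: x = 0 -> x = 0).

Definition filter_regular_seq M (f : seq (mring A n)) : Prop :=
  forall i, (i < size f)%N ->
    filter_regular (mg_quot (ideal_mul M (take i f))) f`_i.

Definition is_hilbert_poly M (H : {mpoly rat[q]}) : Prop :=
  eventually (fun d => exists k,
    is_dim (tensor_frac (component M d)) k /\
    H.@[fun p => (d p)%:R] = k%:R).

(* [msize] is 1 + the total degree, and 0 for the zero polynomial. *)
Definition rdim_eq M (r : int) : Prop :=
  exists2 H, is_hilbert_poly M H & r = (msize H)%:Z - 1.

End Multigraded.

(* Main.v *)
(* All modules are subquotients of M, graded by families of A-submodules of the
   components of M, and everything is read off lengths at a prime p of A, taken
   as lengths of chains of A-submodules that stay strict after localization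
   at p; for p = 0 this is the rank.  Write B_i = (f_0, ..., f_(i-1))M and let
   T_i be the A-torsion of M/B_i.  The ranks of M/B_i drop in degree by
   rank(M/B_(i+1))(e + d) = rank(M/B_i)(e + d) - rank(M/B_i)(d), so M/(f)M is
   eventually torsion.  For p of height one the lengths L_i of T_i satisfy
   L_(i+1)(e + d) = L_i(e + d) - L_i(d) + Z_i(e + d), where Z_i is the length of
   the torsion of (M/B_i)/T_i modulo f_i.  If a kills T_(i+1), that torsion embeds
   into Q/aQ for the torsion-free Q = (M/B_i)/T_i, so Z_i is bounded by l(A/a)
   times the rank of M/B_i; being eventually polynomial (Hilbert-Serre), it has
   at most the degree of that rank.  As T_0 = 0, descending induction leaves
   L_(r+1) eventually constant.  Finally M/(f)M is killed, far enough, by one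
   nonzero a, which lies in only finitely many height-one primes. *)

Require Import Defs.
From HB Require Import structures.
From mathcomp Require Import all_boot all_order all_algebra.
From mathcomp Require Import boolp classical_sets fsbigop.
From mathcomp Require Import freeg mpoly ring.

Set Implicit Arguments.
Unset Strict Implicit.
Unset Printing Implicit Defensive.

Import Order.TTheory Num.Theory GRing.Theory.
Local Open Scope ring_scope.

(** * Submodules and lengths of local chains *)

(** A filter-regular element controls the torsion already present, but not the torsion that dividing
    by it creates. For this excess only an inequality is at hand, and an inequality limits a degree
    only once the smaller function is known to be polynomial: hence Hilbert-Serre and the finite
    generation of graded families. The bound must also be uniform in the multidegree; it is, because
    a torsion family has finitely many homogeneous generators, so that one nonzero scalar kills all
    its components. The torsion length is allowed one degree more than the rank: a difference lowers
    it to the degree of the rank, which is also the degree allowed for the excess, so the margin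
    survives each step. When the rank has become zero, degree at most zero remains for the torsion
    length. Degrees are measured by iterated differences, so that after the initial Hilbert
    polynomial only vanishing far enough out has to be handled. *)

Section SubmodOperations.
Variables (R : nzRingType) (V : lmodType R).
Implicit Types U W Y : submod V.

Definition ssub U W : Prop := forall x, U x -> W x.

Lemma submod_eq U W : ssub U W -> ssub W U -> U = W.
Proof.
case: U W => [u u0 uD uZ] [w w0 wD wZ] /= uw wu.
have e : u = w by apply/funext => x; apply/propext; split; [apply: uw|apply: wu].
by rewrite {}e in u0 uD uZ uw wu *; congr Submod; apply: Prop_irrelevance.
Qed.

Lemma ssub_refl U : ssub U U. Proof. by []. Qed.
Lemma ssub_trans Y U W : ssub U Y -> ssub Y W -> ssub U W.
Proof. by move=> UY YW x /UY/YW. Qed.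

Definition zero_submod : submod V.
Proof.
by exists (fun x => x = 0) => [|x y -> ->|a x ->]; rewrite ?addr0 ?scaler0.
Defined.

Definition full_submod : submod V.
Proof. by exists (fun=> True). Defined.

Definition add_submod U W : submod V.
Proof.
exists (fun x => exists u w, [/\ U u, W w & x = u + w]).
- by exists 0, 0; rewrite addr0; split=> //; apply: submod0.
- move=> _ _ [u [w [Uu Ww ->]]] [u' [w' [Uu' Ww' ->]]]; exists (u + u'), (w + w').
  by rewrite addrACA; split=> //; apply: submodD.
- move=> a _ [u [w [Uu Ww ->]]]; exists (a *: u), (a *: w).
  by rewrite scalerDr; split=> //; apply: submodZ.
Defined.

Definition cap_submod U W : submod V.
Proof.
exists (fun x => U x /\ W x).
- by split; apply: submod0.
- by move=> x y [? ?] [? ?]; split; apply: submodD.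
- by move=> a x [? ?]; split; apply: submodZ.
Defined.

Lemma ssub_full U : ssub U full_submod. Proof. by []. Qed.
Lemma zero_ssub U : ssub zero_submod U.
Proof. by move=> _ ->; apply: submod0. Qed.
Lemma ssub_addl U W : ssub U (add_submod U W).
Proof. by move=> x Ux; exists x, 0; rewrite addr0; split=> //; apply: submod0. Qed.
Lemma ssub_addr U W : ssub W (add_submod U W).
Proof. by move=> x Wx; exists 0, x; rewrite add0r; split=> //; apply: submod0. Qed.
Lemma add_ssub U W Y : ssub U Y -> ssub W Y -> ssub (add_submod U W) Y.
Proof. by move=> UY WY _ [u [w [/UY Yu /WY Yw ->]]]; apply: submodD. Qed.

Lemma submod_sum (I : Type) (r : seq I) (P : pred I) (F : I -> V) U :
  (forall i, P i -> U (F i)) -> U (\sum_(i <- r | P i) F i).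
Proof.
by move=> h; elim/big_ind: _ => //; [apply: submod0|move=> x y; apply: submodD].
Qed.

Section ChainUnion.
Variable c : nat -> submod V.
Hypothesis c_le : forall i j, (i <= j)%N -> ssub (c i) (c j).

Lemma chain_union : exists W, forall x, W x <-> exists i, c i x.
Proof.
unshelve eexists (@Submod _ _ (fun x => exists i, c i x) _ _ _) => //.
- by exists 0%N; apply: submod0.
- move=> x y [i xi] [j yj]; exists (maxn i j); apply: submodD.
    exact: c_le (leq_maxl _ _) _ xi.
  exact: c_le (leq_maxr _ _) _ yj.
- by move=> a x [i xi]; exists i; apply: submodZ.
Qed.

Lemma chain_union_seq (s : seq V) : (forall x, x \in s -> exists i, c i x) ->
  exists i, forall x, x \in s -> c i x.
Proof.
elim: s => [|x s ih] h; first by exists 0%N.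
have [j hj] := h x (mem_head _ _).
have [i hi] : exists i, forall y, y \in s -> c i y.
  by apply: ih => y ys; apply: h; rewrite inE ys orbT.
exists (maxn i j) => y; rewrite inE => /predU1P[->|/hi].
  exact: c_le (leq_maxr _ _) _ hj.
exact: c_le (leq_maxl _ _) _.
Qed.

End ChainUnion.

End SubmodOperations.

Section LinearImage.
Variables (R : nzRingType) (V V' : lmodType R) (F : {linear V -> V'}).

Definition img_submod (U : submod V) : submod V'.
Proof.
exists (fun y => exists2 x, U x & y = F x).
- by exists 0; rewrite ?linear0 //; apply: submod0.
- by move=> _ _ [x Ux ->] [y Uy ->]; exists (x + y); rewrite ?linearD //; apply: submodD.
- by move=> a _ [x Ux ->]; exists (a *: x); rewrite ?linearZ //; apply: submodZ.
Defined.

Definition pre_submod (U : submod V') : submod V.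
Proof.
exists (fun x => U (F x)).
- by rewrite linear0; apply: submod0.
- by move=> x y Ux Uy; rewrite linearD; apply: submodD.
- by move=> a x Ux; rewrite linearZ; apply: submodZ.
Defined.

End LinearImage.

Section ScalingMaps.
Variables (R : comNzRingType) (V : lmodType R).

Definition scale_by (a : R) (x : V) : V := a *: x.
Fact scale_by_is_linear a : linear (scale_by a).
Proof. by move=> b x y; rewrite /scale_by scalerDr !scalerA mulrC. Qed.
HB.instance Definition _ a :=
  GRing.isLinear.Build R V V *:%R (scale_by a) (scale_by_is_linear a).

Definition scale_at (x : V) (a : R^o) : V := (a : R) *: x.
Fact scale_at_is_linear x : linear (scale_at x).
Proof. by move=> b a c; rewrite /scale_at scalerDl scalerA. Qed.
HB.instance Definition _ x :=
  GRing.isLinear.Build R R^o V *:%R (scale_at x) (scale_at_is_linear x).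

End ScalingMaps.

Section LocalChains.
Variables (A : idomainType) (p : primeid A).

Section OneModule.
Variable V : lmodType A.
Implicit Types U W Y : submod V.

(* The extension of [U] to the localization at [p] is strictly contained in
   that of [W]. *)
Definition loc_lt U W : Prop :=
  ssub U W /\ exists x, W x /\ forall s : A, ~ p s -> ~ U (s *: x).

(** The chain may start anywhere above [U], so that it can be moved along inclusions at either
    end. *)
Fixpoint loc_chain k U W : Prop :=
  if k is k'.+1 then exists Y, loc_chain k' U Y /\ loc_lt Y W else ssub U W.

Lemma loc_chain_ssub k U W : loc_chain k U W -> ssub U W.
Proof.
elim: k W => //= k ih W [Y [/ih UY [YW _]]]; exact: ssub_trans YW.
Qed.

Lemma loc_lt_ssubr U Y W : loc_lt U Y -> ssub Y W -> loc_lt U W.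
Proof.
move=> [UY [x [Yx h]]] YW; split; first exact: ssub_trans YW.
by exists x; split=> //; apply: YW.
Qed.

Lemma loc_chain_ssubr k U Y W : loc_chain k U Y -> ssub Y W -> loc_chain k U W.
Proof.
case: k => [|k] /=; first exact: ssub_trans.
by move=> [Z [h lt]] YW; exists Z; split=> //; apply: loc_lt_ssubr YW.
Qed.

Lemma loc_chain_ssubl k U Y W : ssub U Y -> loc_chain k Y W -> loc_chain k U W.
Proof.
elim: k W => [|k ih] W UY /=; first exact: ssub_trans.
by move=> [Z [h lt]]; exists Z; split=> //; apply: ih.
Qed.

Lemma loc_chain_cat j k U Y W :
  loc_chain j U Y -> loc_chain k Y W -> loc_chain (k + j) U W.
Proof.
move=> UY; elim: k W => [|k ih] W /=; first exact: loc_chain_ssubr.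
by move=> [Z [/ih UZ ZW]]; exists Z.
Qed.

Lemma loc_chainW k U W : loc_chain k.+1 U W -> loc_chain k U W.
Proof. by move=> [Y [UY [YW _]]]; apply: loc_chain_ssubr YW. Qed.

Lemma loc_chain_le j k U W : (j <= k)%N -> loc_chain k U W -> loc_chain j U W.
Proof.
move=> /subnK <-; elim: (k - j)%N => // i ih.
by rewrite addSn => /loc_chainW.
Qed.

(** The witness [x] of strictness either survives modulo [Y], or [s *: x = u + y] for some [s]
    outside [p], and then [y] is a witness for the intersections. *)
Lemma loc_lt_split U W Y : loc_lt U W ->
  loc_lt (cap_submod U Y) (cap_submod W Y) \/
  loc_lt (add_submod U Y) (add_submod W Y).
Proof.
move=> [UW [x [Wx h]]]; have [//|nlt] := EM (loc_lt (cap_submod U Y) (cap_submod W Y)).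
  by left.
right; split.
  by move=> _ [u [y [/UW Wu Yy ->]]]; exists u, y.
exists x; split; first exact: ssub_addl.
move=> s ps [u [y [Uu Yy sx]]]; apply: nlt; split.
  by move=> z [/UW Wz Yz].
exists y; split.
  split=> //; rewrite (_ : y = s *: x - u); last by rewrite sx addrC addKr.
  by apply: submodB; [apply: submodZ|apply: UW].
move=> s' ps' [Usy _]; apply: (h (s' * s)); first exact: primeidNM.
by rewrite -scalerA sx scalerDr; apply: submodD => //; apply: submodZ.
Qed.

(** Each strict step is charged to one side while the other side keeps an inclusion. *)
Lemma loc_chain_split k U W Y : loc_chain k U W -> exists j i,
  [/\ (j + i = k)%N, loc_chain j (cap_submod U Y) (cap_submod W Y) &
      loc_chain i (add_submod U Y) (add_submod W Y)].
Proof.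
elim: k W => [|k ih] W /=.
  move=> UW; exists 0%N, 0%N; split=> //= [x [/UW Wx Yx] //|].
  by apply: add_ssub; [apply: ssub_trans UW (@ssub_addl _ _ _ _)|apply: ssub_addr].
move=> [Z [/ih[j [i [jik cj ci]]] ZW]]; have ZW' := ZW.1.
have [lt|lt] := loc_lt_split Y ZW.
  exists j.+1, i; split; rewrite ?addSn ?jik //; first by exists (cap_submod Z Y).
  apply: loc_chain_ssubr ci _.
  by apply: add_ssub; [apply: ssub_trans ZW' (@ssub_addl _ _ _ _)|apply: ssub_addr].
exists j, i.+1; split; rewrite ?addnS ?jik //; last by exists (add_submod Z Y).
by apply: loc_chain_ssubr cj _ => x [/ZW' ? ?].
Qed.

Definition fin_len U W : Prop := exists k, ~ loc_chain k U W.

Definition is_len U W (k : nat) : Prop :=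
  loc_chain k U W /\ ~ loc_chain k.+1 U W.

Lemma is_len_unique U W j k : is_len U W j -> is_len U W k -> j = k.
Proof.
move=> [cj nj] [ck nk]; apply/eqP; rewrite eqn_leq.
apply/andP; split; rewrite leqNgt; apply/negP => lt.
  exact: nk (loc_chain_le lt cj).
exact: nj (loc_chain_le lt ck).
Qed.

Lemma fin_len_ex U W : ssub U W -> fin_len U W -> exists k, is_len U W k.
Proof.
move=> UW [k]; elim: k => [//|k ih] nk.
by have [ck|/ih//] := EM (loc_chain k U W); exists k.
Qed.

Lemma is_len_fin U W k : is_len U W k -> fin_len U W.
Proof. by move=> [_ h]; exists k.+1. Qed.

(** The value 0 also stands for infinite length, so additivity of [len] has to assume [fin_len];
    [is_len] includes finiteness. *)
Definition len U W : nat := xget 0%N [set k | is_len U W k].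

Lemma lenP U W : ssub U W -> fin_len U W -> is_len U W (len U W).
Proof.
move=> UW /(fin_len_ex UW)[k kP]; rewrite /len.
by case: xgetP => [_ -> //|/(_ k)].
Qed.

Lemma len_eq U W k : is_len U W k -> len U W = k.
Proof.
move=> h; apply: (is_len_unique _ h); apply: lenP (is_len_fin h).
exact: loc_chain_ssub h.1.
Qed.

(** Split at [Y], any chain from [U] to [W] has at most [i] steps below and at most [j] above; this
    takes the place of the Jordan-Hoelder theorem. *)
Lemma is_len_add U Y W i j :
  is_len U Y i -> is_len Y W j -> is_len U W (i + j).
Proof.
move=> [ci ni] [cj nj]; split; first by rewrite addnC; apply: loc_chain_cat cj.
have UY := loc_chain_ssub ci; have YW := loc_chain_ssub cj.
move=> /(loc_chain_split Y)[i' [j' [e c1 c2]]].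
have {}c1 : loc_chain i' U Y.
  by move: c1; congr (loc_chain _ _ _); apply: submod_eq => x; [case| |case|] => // h;
    split=> //; [apply: UY|apply: YW].
have {}c2 : loc_chain j' Y W.
  move: c2; congr (loc_chain _ _ _); apply: submod_eq => //;
    by [apply: add_ssub|apply: ssub_addr|apply: ssub_addl].
have li : (i' <= i)%N by rewrite leqNgt; apply/negP => lt; exact: ni (loc_chain_le lt c1).
have lj : (j' <= j)%N by rewrite leqNgt; apply/negP => lt; exact: nj (loc_chain_le lt c2).
have := leq_add li lj.
by rewrite e ltnn.
Qed.

Lemma fin_lenSl U Y W : ssub U Y -> ssub Y W -> fin_len U W -> fin_len U Y.
Proof. by move=> UY YW [k nk]; exists k => c; apply: nk; apply: loc_chain_ssubr YW. Qed.

Lemma fin_lenSr U Y W : ssub U Y -> ssub Y W -> fin_len U W -> fin_len Y W.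
Proof. by move=> UY YW [k nk]; exists k => c; apply: nk; apply: loc_chain_ssubl UY _. Qed.

Lemma fin_len_trans U Y W : ssub U Y -> ssub Y W ->
  fin_len U Y -> fin_len Y W -> fin_len U W.
Proof.
move=> UY YW /(fin_len_ex UY)[i hi] /(fin_len_ex YW)[j hj].
exact: is_len_fin (is_len_add hi hj).
Qed.

Lemma len_add U Y W : ssub U Y -> ssub Y W -> fin_len U W ->
  len U W = (len U Y + len Y W)%N.
Proof.
move=> UY YW fl; apply: len_eq; apply: is_len_add; apply: lenP => //.
  exact: fin_lenSl fl.
exact: fin_lenSr fl.
Qed.

(** At the zero prime the right-hand side says that [W] is torsion modulo [U]. *)
Lemma is_len0P U W : ssub U W ->
  is_len U W 0 <-> forall x, W x -> exists s : A, ~ p s /\ U (s *: x).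
Proof.
move=> UW; split=> [[_ n1] x Wx|h].
  apply: contrapT => nx; apply: n1; exists U; split=> //; split=> //.
  by exists x; split=> // s ps Us; apply: nx; exists s.
split=> // -[Y [/= UY [_ [x [/h[s [ps Us]] /(_ s ps)]]]]]; apply; exact: UY.
Qed.

Lemma is_len_refl U : is_len U U 0.
Proof.
by apply/is_len0P => // x Ux; exists 1; rewrite scale1r; split=> //; apply: primeid1.
Qed.

Lemma len_refl U : len U U = 0%N. Proof. exact/len_eq/is_len_refl. Qed.

End OneModule.

Section Isomorphism.
Variables (V V' : lmodType A) (F : {linear V -> V'}).
Variables (W : submod V) (U : submod V').

(** First isomorphism theorem for chains: they are carried by images one way and by preimages the
    other. *)
Lemma loc_chain_iso k :
  loc_chain k (cap_submod (pre_submod F U) W) W <->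
  loc_chain k U (add_submod (img_submod F W) U).
Proof.
split.
  have : ssub W W by [].
  (* Only the top of the chain is generalized; the bottom keeps the full [W], so [W0] has to stay
     inside it. *)
  move: {1 4 5}W => W0; elim: k W0 => [|k ih] W0 W0W; first by move=> _; apply: ssub_addr.
  move=> [Y [c [YW0 [x [W0x h]]]]]; have YW := ssub_trans YW0 W0W.
  exists (add_submod (img_submod F Y) U); split; first exact: ih.
  split; first by move=> _ [_ [u [[y /YW0 Wy ->] Uu ->]]]; exists (F y), u; split=> //; exists y.
  exists (F x); split; first by apply: ssub_addl; exists x.
  move=> s ps [_ [u [[y Yy ->] Uu e]]]; apply: (h s ps).
  rewrite -(subrK y (s *: x)); apply: submodD => //.
  apply: (loc_chain_ssub c); split; last first.
    by apply: submodB; [apply/submodZ/W0W|apply: YW].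
  by rewrite /= linearB linearZ /= e addrC addKr.
move=> c; have {c} : exists2 W', ssub W' (add_submod (img_submod F W) U) &
    W = cap_submod (pre_submod F W') W /\ loc_chain k U W'.
  exists (add_submod (img_submod F W) U) => //; split=> //.
  apply: submod_eq => [x Wx|x [] //]; split=> //.
  by apply: ssub_addl; exists x.
move=> [W' W'W [eW c]]; rewrite {2}eW.
elim: k W' W'W c {eW} => [|k ih] W' W'W /=; first by move=> UW' x [/UW' ? ?].
move=> [Y [c [YW' [x [W'x h]]]]].
exists (cap_submod (pre_submod F Y) W); split.
  by apply: ih => //; apply: ssub_trans W'W.
split; first by move=> y [/YW' ? ?].
have [_ [u [[w Ww ->] Uu e]]] := W'W _ W'x; exists w; split.
  split=> //=; rewrite (_ : F w = x - u); last by rewrite e addrK.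
  apply: submodB => //; apply: YW'; exact: loc_chain_ssub c _ _.
move=> s ps [/= Ysw _]; apply: (h s ps); rewrite e scalerDr -linearZ.
by apply: submodD => //; apply/submodZ/(loc_chain_ssub c).
Qed.

Lemma is_len_iso k : is_len (cap_submod (pre_submod F U) W) W k <->
  is_len U (add_submod (img_submod F W) U) k.
Proof.
by split=> -[c n]; split; [exact/loc_chain_iso| |exact/loc_chain_iso|];
  move: n; apply: contra_not => /loc_chain_iso.
Qed.

Lemma len_iso : len (cap_submod (pre_submod F U) W) W =
  len U (add_submod (img_submod F W) U).
Proof.
by rewrite /len; congr xget; apply/funext => k; apply/propext; apply: is_len_iso.
Qed.

End Isomorphism.

End LocalChains.

(** * Localization and height-one primes *)

Section LocalizedLength.
Variables (A : idomainType) (p : primeid A) (N : lmodType A).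
Local Notation L := (loc_mod p N).
Local Notation one_denom := (mkdenom (primeid1 p)).

Lemma in_loc_pred (b t : A) (pt : ~ p t) : tofrac b / tofrac t \in loc_pred p.
Proof. by apply/asboolP; exists b, t. Qed.

Definition loc_frac (b t : A) (pt : ~ p t) : loc_ring p :=
  exist (fun x => x \in loc_pred p) _ (in_loc_pred b pt).

Lemma loc_fracZ (b t : A) (pt : ~ p t) (x : N) s :
  loc_frac b pt *: lfrac x s = lfrac (b *: x) (denomM (mkdenom pt) s).
Proof. exact: lscaleE. Qed.

Definition contraction (W : submod L) : submod N.
Proof.
exists (fun x => W (lfrac x one_denom)).
- exact: submod0.
- move=> x y Wx Wy; rewrite (_ : lfrac _ _ = lfrac x one_denom + lfrac y one_denom).
    exact: submodD.
  by rewrite [RHS]laddE; apply: lfrac_eq; rewrite /= !scale1r mul1r scale1r.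
- move=> a x Wx; rewrite (_ : lfrac _ _ = loc_frac a (primeid1 p) *: lfrac x one_denom).
    exact: submodZ.
  by rewrite loc_fracZ; apply: lfrac_eq; rewrite /= !mul1r.
Defined.

Definition extension (U : submod N) : submod L.
Proof.
exists (fun z => exists x s, U x /\ z = lfrac x s).
- by exists 0, one_denom; split=> //; apply: submod0.
- move=> _ _ [x [s [Ux ->]]] [y [t [Uy ->]]].
  exists (val t *: x + val s *: y), (denomM s t); split; last exact: laddE.
  by apply: submodD; apply: submodZ.
- move=> a _ [x [s [Ux ->]]].
  exists (loc_num a *: x), (denomM (mkdenom (loc_denP a)) s); split.
    exact: submodZ.
  exact: lscale_numden.
Defined.

Lemma contraction_lfrac (W : submod L) x s : W (lfrac x s) -> contraction W x.
Proof.
move=> Wx; rewrite /= (_ : lfrac _ _ = loc_frac (val s) (primeid1 p) *: lfrac x s).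
  exact: submodZ.
by rewrite loc_fracZ; apply: lfrac_eq; rewrite /= scale1r mul1r.
Qed.

Lemma contraction_lt (W W' : submod L) : submod_lt W W' ->
  loc_lt p (contraction W) (contraction W').
Proof.
move=> [WW' [z []]]; elim/loc_mod_ind: z => x s W'x nWx.
split; first by move=> y /WW'.
exists x; split; first exact: contraction_lfrac W'x.
move=> t pt /= Wtx; apply: nWx.
have pts : ~ p (t * val s) by apply: primeidNM => //; apply: loc_denomP.
rewrite (_ : lfrac x s = loc_frac 1 pts *: lfrac (t *: x) one_denom).
  exact: submodZ.
rewrite loc_fracZ; apply: lfrac_eq; rewrite /= scale1r mulr1 scalerA.
by rewrite mulrC.
Qed.

Lemma extension_lt (U W : submod N) : loc_lt p U W ->
  submod_lt (extension U) (extension W).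
Proof.
move=> [UW [x [Wx h]]]; split.
  by move=> _ [y [s [/UW Wy ->]]]; exists y, s.
exists (lfrac x one_denom); split; first by exists x, one_denom.
move=> [y [s [Uy /lfracP[u [pu /eqP]]]]]; rewrite scalerBr subr_eq0 => /eqP e.
apply: (h (u * val s)); first by apply: primeidNM => //; apply: loc_denomP.
by rewrite -scalerA e; do 2!apply: submodZ.
Qed.

(** Contraction turns strict inclusions over the local ring into inclusions strict at [p], and
    extension does the converse. *)
Lemma submod_chain_locP k :
  submod_chain L k <-> loc_chain p k (zero_submod N) (full_submod N).
Proof.
split=> [[c hc]|].
  apply: loc_chain_ssubl (zero_ssub (contraction (c 0%N))) _.
  apply: (@loc_chain_ssubr _ _ _ _ _ (contraction (c k))) => //.
  elim: k hc => [|k ih] hc //=.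
  exists (contraction (c k)); split; last exact/contraction_lt/hc.
  by apply: ih => i ik; apply: hc; apply: ltn_trans ik _.
suff h W : loc_chain p k (zero_submod N) W ->
    exists2 c : nat -> submod L, c k = extension W &
      forall i, (i < k)%N -> submod_lt (c i) (c i.+1).
  by move=> /h[c _ hc]; exists c.
elim: k W => [|k ih] W /=; first by exists (fun=> extension W).
move=> [Y [/ih[c ck hc] /extension_lt lt]].
exists (fun i => if (i <= k)%N then c i else extension W); first by rewrite ltnn.
move=> i; rewrite ltnS leq_eqVlt => /predU1P[->|ik] /=.
  by rewrite eqxx ltnn /= ck.
by rewrite ik orbT; apply: hc.
Qed.

Lemma mlength_loc_mod : mlength L = len p (zero_submod N) (full_submod N).
Proof.
rewrite /mlength /len; congr xget; apply/funext => k; apply/propext.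
by split=> -[c n]; split; [exact/submod_chain_locP| |exact/submod_chain_locP|];
  move: n; apply: contra_not => /submod_chain_locP.
Qed.

End LocalizedLength.

Section NoetherianInduction.
Variables (R : nzRingType) (V : lmodType R).
Implicit Types U W : submod V.

Lemma mem_span (s : seq V) x : x \in s -> Defs.span s x.
Proof.
move=> xs; have ixs : (index x s < size s)%N by rewrite index_mem.
exists (fun i => if i == index x s then 1 else 0).
rewrite (bigD1 (Ordinal ixs)) //= eqxx scale1r nth_index // big1 ?addr0 //.
by move=> i ne; rewrite (_ : _ == _ = false) ?scale0r //; apply/negbTE: ne.
Qed.

Lemma span_ssub (s : seq V) U : (forall x, x \in s -> U x) -> forall x, Defs.span s x -> U x.
Proof.
move=> sU _ [c ->]; apply: submod_sum => i _; apply/submodZ/sU.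
exact: mem_nth.
Qed.

(** A counterexample would start an infinite strictly increasing chain; its union has finitely many
    generators, all of them in one term. *)
Lemma noetherian_ind : (forall U, fin_gen_submod U) ->
  forall P : submod V -> Prop,
    (forall U, (forall W, ssub U W -> ~ ssub W U -> P W) -> P U) ->
  forall U, P U.
Proof.
move=> noeth P ind; apply: contrapT => /existsNP[U0 nU0].
have next (U : {U | ~ P U}) : {W : {W | ~ P W} | submod_lt (sval U) (sval W)}.
  apply: cid; case: U => U nU /=; apply: contrapT => nW; apply: nU; apply: ind => W UW nWU.
  apply: contrapT => nPW; apply: nW; exists (exist _ W nPW); split=> //=.
  by apply: contrapT => h; apply: nWU => x Wx; apply: contrapT => nUx; apply: h; exists x.
pose c i := iter i (fun X => sval (next X)) (exist _ U0 nU0).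
have cS i : submod_lt (sval (c i)) (sval (c i.+1)) by rewrite /c iterS; case: (next _).
have cle i j : (i <= j)%N -> ssub (sval (c i)) (sval (c j)).
  move=> /subnK<-; elim: (j - i)%N => // k ih x /ih; rewrite addSn.
  exact: (cS _).1.
have [Un UnE] := chain_union cle; have [s hs] := noeth Un.
have [i hi] : exists i, forall x, x \in s -> sval (c i) x.
  by apply: (chain_union_seq cle) => x /mem_span/hs/UnE.
have [x [x1 nx]] := (cS i).2; apply: nx.
by apply: (span_ssub hi); apply/hs/UnE; exists i.+1.
Qed.

End NoetherianInduction.

Section Ideals.
Variable A : idomainType.
Implicit Types I J : submod A^o.

Lemma ideal_mull I (a b : A) : I b -> I (a * b). Proof. exact: (@submodZ _ _ I a b). Qed.
Lemma ideal_mulr I (a b : A) : I a -> I (a * b).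
Proof. by rewrite mulrC; apply: ideal_mull. Qed.

Lemma ideal1_full I : I 1 -> I = full_submod A^o.
Proof. by move=> I1; apply: submod_eq => // a _; rewrite -[a]mulr1; apply: ideal_mull. Qed.

Definition principal (a : A) : submod A^o :=
  img_submod (scale_at (a : A^o)) (full_submod A^o).

Lemma principal_mem (a : A) : principal a a. Proof. by exists 1 => //; apply/esym/scale1r. Qed.

Lemma add_principal_proper I (a : A) : ~ I a ->
  ssub I (add_submod I (principal a)) /\ ~ ssub (add_submod I (principal a)) I.
Proof.
move=> nIa; split; first exact: ssub_addl.
by move=> /(_ a) h; apply/nIa/h/ssub_addr/principal_mem.
Qed.

(** Takes the place of prime filtrations: a proper ideal that is not prime contains a product of two
    elements outside it, and is handled through strictly larger ideals. *)
Lemma ideal_ind : noetherian A -> forall P : submod A^o -> Prop,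
  P (full_submod A^o) -> (forall q : primeid A, P q) ->
  (forall I (a b : A), ~ I a -> ~ I b -> I (a * b) ->
     (forall J, ssub I J -> ~ ssub J I -> P J) -> P I) ->
  forall I, P I.
Proof.
move=> noeth P P1 Pprime Pmul; apply: noetherian_ind => // I ih.
have [/ideal1_full -> //|nI1] := EM (I 1).
have [h|] := EM (forall a b, I (a * b) -> I a \/ I b); first exact: (Pprime (PrimeId nI1 h)).
move=> /existsNP[a /existsNP[b /not_implyP[Iab /not_orP[nIa nIb]]]].
exact: Pmul nIa nIb Iab ih.
Qed.

Definition zero_prime : primeid A.
Proof.
exists (zero_submod A^o) => [|a b] /=; first by apply/eqP; rewrite oner_eq0.
by move/eqP; rewrite mulf_eq0 => /orP[]/eqP; [left|right].
Defined.

Lemma ht1prime_eq (p : primeid A) (q : primeid A) (a : A) :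
  height_eq p 1 -> q a -> a != 0 -> ssub q p -> q = p :> submod A^o.
Proof.
move=> [_ n2] qa a0 qp; apply: submod_eq => // x px.
apply: contrapT => nqx; apply: n2.
exists (fun i => match i with 0 => zero_prime | 1 => q | _ => p end); split=> //.
case=> [|[|//]] _; split=> //.
- by move=> _ ->; apply: submod0.
- by exists a; split=> //=; apply/eqP.
- by exists x.
Qed.

(** A prime over [I] contains [a * b], hence lies over [I + (a)] or [I + (b)]; over a nonzero prime
    the only candidate is that prime itself. *)
Lemma ht1primes_over : noetherian A -> forall I, (exists2 a : A, I a & a != 0) ->
  exists s : seq (ht1prime A), forall p : ht1prime A, ssub I (val p) -> p \in s.
Proof.
move=> noeth; apply: ideal_ind => //.
- by move=> _; exists [::] => p /(_ 1 Logic.I) /primeid1.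
- move=> q [a qa a0]; have [hq|hq] := EM (height_eq q 1).
    exists [:: exist _ q (asboolT hq)] => -[p hp] /= qp; rewrite inE; apply/eqP.
    have e := ht1prime_eq (asboolW hp) qa a0 qp; apply: val_inj => /=.
    case: p q e {hp hq qa qp} => [p p1 pM] [q q1 qM] /= e.
    by rewrite {}e in q1 qM *; congr PrimeId; apply: Prop_irrelevance.
  exists [::] => -[p hp] /= qp; case: hq.
  have e := ht1prime_eq (asboolW hp) qa a0 qp.
  suff -> : q = p by apply: asboolW.
  case: p q e {hp qa qp} => [p p1 pM] [q q1 qM] /= e.
  by rewrite {}e in q1 qM *; congr PrimeId; apply: Prop_irrelevance.
- move=> I a b nIa nIb Iab ih [c Ic c0].
  have h J : ssub I J -> ~ ssub J I ->
      exists s : seq (ht1prime A), forall p : ht1prime A, ssub J (val p) -> p \in s.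
    by move=> IJ nJI; apply: ih => //; exists c => //; apply: IJ.
  have [Ia nIa'] := add_principal_proper nIa; have [Ib nIb'] := add_principal_proper nIb.
  have [s hs] := h _ Ia nIa'; have [t ht] := h _ Ib nIb'.
  exists (s ++ t) => p Ip; rewrite mem_cat.
  have add_p x : val p x -> ssub (add_submod I (principal x)) (val p).
    by move=> px; apply: add_ssub => // _ [y _ ->]; apply: ideal_mull.
  by have [/add_p/hs->|/add_p/ht->] := primeidM (Ip _ Iab); rewrite ?orbT.
Qed.

Lemma common_denominator (T : eqType) (G : seq T) (I : T -> submod A^o) :
  (forall g, g \in G -> exists2 a : A, a != 0 & I g a) ->
  exists2 a : A, a != 0 & forall g, g \in G -> I g a.
Proof.
elim: G => [|g G ih] h; first by exists 1; rewrite ?oner_eq0.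
have [|a a0 aG] := ih; first by move=> g' g'G; apply: h; rewrite inE g'G orbT.
have [b b0 bg] := h g (mem_head _ _).
exists (a * b); first by rewrite mulf_neq0.
move=> g'; rewrite inE => /predU1P[->|/aG]; first exact: ideal_mull.
exact: ideal_mulr.
Qed.

End Ideals.

Section FiniteLength.
Variables (A : idomainType) (p : primeid A).
Implicit Type I : submod A^o.

Lemma is_len_prime : is_len p p (full_submod A^o) 1.
Proof.
split=> /=.
  exists p; split=> //; split=> //; exists 1; split=> // s ps.
  by rewrite /GRing.scale /= mulr1.
move=> [Y [[Z [pZ [ZY [x [Yx nZx]]]]] [_ [y [_ nYy]]]]].
have npx : ~ p x.
  by move=> /pZ Zx; apply: (nZx 1); [apply: primeid1|rewrite scale1r].
by apply: (nYy x npx); rewrite /GRing.scale /= mulrC; apply: ideal_mull.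
Qed.

Lemma is_len_notin I (s : A) : I s -> ~ p s -> is_len p I (full_submod A^o) 0.
Proof.
move=> Is ps; apply/is_len0P => // x _; exists s; split=> //.
exact: ideal_mulr.
Qed.

(** [A x + U] modulo [U] is [A] modulo the colon ideal [(U : x)], here the preimage of [U] under
    [scale_at x]. *)
Lemma colon_len (V : lmodType A) (U : submod V) (x : V) k :
  is_len p (pre_submod (scale_at x) U) (full_submod A^o) k ->
  is_len p U (add_submod (img_submod (scale_at x) (full_submod A^o)) U) k.
Proof.
move=> h; apply/is_len_iso; move: h; congr (is_len _ _ _ _).
by apply: submod_eq => // a [].
Qed.

Lemma colon_fin_len (V : lmodType A) (U : submod V) (x : V) :
  fin_len p (pre_submod (scale_at x) U) (full_submod A^o) ->
  fin_len p U (add_submod (img_submod (scale_at x) (full_submod A^o)) U).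
Proof. by move=> /(fin_len_ex (@ssub_full _ _ _))[k /colon_len]; apply: is_len_fin. Qed.

(** In the composite case [I + (a)] modulo [I] is [A] modulo [(I : a)]; this colon ideal contains
    [b], so it and [I + (a)] are both strictly larger than [I]. *)
Lemma ideal_fin_len : noetherian A -> height_eq p 1 ->
  forall I, (exists2 a : A, I a & a != 0) -> fin_len p I (full_submod A^o).
Proof.
move=> noeth hp; apply: ideal_ind => //.
- by move=> _; apply: is_len_fin (is_len_refl _ _).
- move=> q [a qa a0]; have [qp|] := EM (ssub q p).
    rewrite (ht1prime_eq hp qa a0 qp); exact: is_len_fin is_len_prime.
  by move=> /existsNP[s /not_implyP[qs ps]]; apply: is_len_fin (is_len_notin qs ps).
move=> I a b nIa nIb Iab ih [c Ic c0].
have h J : ssub I J -> ~ ssub J I -> fin_len p J (full_submod A^o).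
  by move=> IJ nJI; apply: ih => //; exists c => //; apply: IJ.
have [Ia nIa'] := add_principal_proper nIa.
apply: (@fin_len_trans _ _ _ _ (add_submod I (principal a))) => //; last exact: h.
rewrite (_ : add_submod _ _ = add_submod (principal a) I); last first.
  by apply: submod_eq; apply: add_ssub; (apply: ssub_addl || apply: ssub_addr).
apply: colon_fin_len; apply: h => [x Ix|/(_ b) h]; first exact: ideal_mulr.
by apply/nIb/h; rewrite /= /scale_at /GRing.scale /= mulrC.
Qed.

(** The generators are adjoined to [U] one at a time; each step is a cyclic quotient whose
    annihilator contains [a]. *)
Lemma torsion_fin_len (V : lmodType A) (U W : submod V) (a : A) (s : seq V) :
  noetherian A -> height_eq p 1 -> a != 0 ->
  (forall x, W x -> U (a *: x)) -> ssub U W -> (forall x, x \in s -> W x) ->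
  (forall Y : submod V, ssub U Y -> (forall x, x \in s -> Y x) -> ssub W Y) ->
  fin_len p U W.
Proof.
move=> noeth hp a0 aWU.
elim: s U aWU => [|x s ih] U aWU UW sW gen.
  have -> : U = W by apply: submod_eq => //; apply: gen.
  exact: is_len_fin (is_len_refl _ _).
have Wx : W x by apply: sW; rewrite mem_head.
pose U' := add_submod (img_submod (scale_at x) (full_submod A^o)) U.
have UU' : ssub U U' by apply: ssub_addr.
have U'W : ssub U' W by apply: add_ssub => // _ [b _ ->]; apply: submodZ.
apply: (fin_len_trans UU' U'W).
  apply: colon_fin_len; apply: ideal_fin_len => //; exists a => //.
  exact: aWU.
apply: ih => // [y /aWU/UU' //|y ys|Y U'Y sY]; first by apply: sW; rewrite inE ys orbT.
apply: gen => [|y]; first exact: ssub_trans UU' U'Y.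
rewrite inE => /predU1P[->|/sY//]; apply: U'Y; apply: ssub_addl.
by exists 1 => //; apply/esym/scale1r.
Qed.

End FiniteLength.

(** * Hilbert's basis theorem *)

Lemma seq_choice (T U : eqType) (P : T -> U -> Prop) (s : seq T) :
  (forall x, x \in s -> exists y, P x y) ->
  exists r : seq U, (forall x, x \in s -> exists2 y, y \in r & P x y) /\
    (forall y, y \in r -> exists2 x, x \in s & P x y).
Proof.
elim: s => [|x s ih] h; first by exists [::].
have [r [sr rs]] : exists r : seq U, (forall x, x \in s -> exists2 y, y \in r & P x y) /\
    (forall y, y \in r -> exists2 x, x \in s & P x y).
  by apply: ih => y ys; apply: h; rewrite inE ys orbT.
have [y Pxy] := h x (mem_head _ _); exists (y :: r); split=> z; rewrite inE.
  move=> /predU1P[->|/sr[z' z'r Pz]]; first by exists y; rewrite ?mem_head.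
  by exists z'; rewrite // inE z'r orbT.
move=> /predU1P[->|/rs[z' z's Pz]]; first by exists x; rewrite ?mem_head.
by exists z'; rewrite // inE z's orbT.
Qed.

Section HilbertBasis.
Variables (A : idomainType) (V : lmodType A) (m : nat) (t : 'I_m -> {linear V -> V}).
Hypothesis tC : forall i j x, t i (t j x) = t j (t i x).
Implicit Types (U W X Y : submod V) (s : seq 'I_m) (G : seq V).

Definition stable s U : Prop := forall k, k \in s -> forall x, U x -> U (t k x).

Definition generates s G U : Prop := (forall g, g \in G -> U g) /\
  forall Y, stable s Y -> (forall g, g \in G -> Y g) -> ssub U Y.

(** The Noetherian property over [A[t_k : k in s]], phrased with commuting endomorphisms so that
    variables can be added one by one; for empty [s] it is the property over [A]. *)
Definition noetherian_under s X : Prop :=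
  forall U, ssub U X -> stable s U -> exists G, generates s G U.

Lemma stable_add s U W : stable s U -> stable s W -> stable s (add_submod U W).
Proof.
move=> sU sW k ks _ [u [w [Uu Ww ->]]]; exists (t k u), (t k w).
by rewrite linearD; split=> //; [apply: sU|apply: sW].
Qed.

Lemma stable_cap s U W : stable s U -> stable s W -> stable s (cap_submod U W).
Proof. by move=> sU sW k ks x [Ux Wx]; split; [apply: sU|apply: sW]. Qed.

Lemma stable_sub s1 s2 U : {subset s1 <= s2} -> stable s2 U -> stable s1 U.
Proof. by move=> s12 h k /s12; apply: h. Qed.

(** [U] is recovered from its intersection with [X] and from lifts of generators of the ideal of
    those [a] with [a *: g] in [U + X]. *)
Lemma noetherian_add_span X (g : V) : noetherian A ->
  noetherian_under [::] X ->
  noetherian_under [::] (add_submod X (img_submod (scale_at g) (full_submod A^o))).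
Proof.
move=> noeth nX U UX _.
have [|//|G [GU Ggen]] := nX (cap_submod U X); first by move=> x [].
have [s hs] := noeth (pre_submod (scale_at g) (add_submod U X)).
have [r [sr rs]] : exists r : seq V,
    (forall a, a \in s -> exists2 u, u \in r & U u /\ X ((a : A) *: g - u)) /\
    (forall u, u \in r -> exists2 a, a \in s & U u /\ X ((a : A) *: g - u)).
  apply: (@seq_choice A V (fun a u => U u /\ X (a *: g - u))).
  move=> a /(@mem_span _ A^o) /hs [u [x [Uu Xx e]]]; exists u; split=> //.
  by rewrite -[_ *: g]/(scale_at g a) e addrAC subrr add0r.
exists (G ++ r); split.
  by move=> x; rewrite mem_cat => /orP[/GU[]//|/rs[a _ []]].
move=> Y _ GY.
have YG x : x \in G -> Y x by move=> xG; apply: GY; rewrite mem_cat xG.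
have Yr x : x \in r -> Y x by move=> xr; apply: GY; rewrite mem_cat xr orbT.
have UXY x : U x -> X x -> Y x by move=> Ux Xx; apply: Ggen.
move=> x Ux; have [x' [_ [Xx' [a _ ->] e]]] := UX _ Ux.
have [y [x'' [[Yy Uy] Xx'' e']]] :
    pre_submod (scale_at g) (add_submod (cap_submod Y U) X) a.
  have : Defs.span s a.
    by apply/hs; exists x, (- x'); split=> //; [apply: submodN|rewrite e addrAC subrr add0r].
  apply: span_ssub => b bs; have [u ur [Uu Xb]] := sr b bs.
  exists u, (b *: g - u); split=> //; last by rewrite addrCA subrr addr0.
  by split=> //; apply: Yr.
rewrite -(subrK y x); apply: submodD => //; apply: UXY; first exact: submodB.
by rewrite e e' addrA addrAC addrK; apply: submodD.
Qed.

Section Step.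
Variables (k : 'I_m) (s : seq 'I_m) (X : submod V).
Hypotheses (sX : stable s X) (nX : noetherian_under s X).

Lemma iter_img_stable n : stable s (iter n (img_submod (t k)) X).
Proof.
elim: n => [|n ih] //= j js _ [x Px ->]; exists (t j x); first exact: ih.
exact: tC.
Qed.

Lemma iter_imgP n x : iter n (img_submod (t k)) X x ->
  exists2 g, X g & x = iter n (t k) g.
Proof.
elim: n x => [|n ih] x /=; first by exists x.
by move=> [y /ih[g Xg ->] ->]; exists g.
Qed.

Lemma iter_preP n U x : iter n (pre_submod (t k)) U x <-> U (iter n (t k) x).
Proof. by elim: n x => [|n ih] x //; rewrite iterS iterSr -ih. Qed.

Lemma iter_tC n j x : t j (iter n (t k) x) = iter n (t k) (t j x).
Proof. by elim: n => //= n <-; rewrite tC. Qed.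

(** [X + t X + ... + t^(n-1) X]: the elements of degree less than [n] in [t k]. *)
Fixpoint layer n : submod V :=
  if n is n'.+1 then add_submod (layer n') (iter n' (img_submod (t k)) X)
  else zero_submod V.

Lemma layer_stable n : stable s (layer n).
Proof.
elim: n => [|n ih] /=; first by move=> j _ x ->; rewrite /= linear0.
by apply: stable_add => //; apply: iter_img_stable.
Qed.

Lemma layer_le n1 n2 : (n1 <= n2)%N -> ssub (layer n1) (layer n2).
Proof.
move=> /subnK<-; elim: (n2 - n1)%N => // j ih.
exact: ssub_trans ih (@ssub_addl _ _ _ _).
Qed.

Lemma layer_shift n x : layer n x -> layer n.+1 (t k x).
Proof.
elim: n x => [|n ih] x; first by move=> ->; rewrite linear0; apply: submod0.
move=> [y [z [/ih ly Iz ->]]]; rewrite linearD.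
by exists (t k y), (t k z); split=> //; exists z.
Qed.

(* The coefficients of [t^n] in the elements of [W] of degree at most [n] in [t]. *)
Definition lead_coefs W n : submod V :=
  cap_submod X (iter n (pre_submod (t k)) (add_submod W (layer n))).

Lemma lead_coefsP W n g : lead_coefs W n g <->
  X g /\ exists w l, [/\ W w, layer n l & iter n (t k) g = w + l].
Proof. split=> -[Xg h]; split=> //.
  exact: (iter_preP _ _ _).1 h.
exact: (iter_preP _ (add_submod W (layer n)) _).2 h. Qed.

Lemma lead_coefs_stable W n : stable s W -> stable s (lead_coefs W n).
Proof.
move=> sW; apply: stable_cap => // j js x /iter_preP h; apply/iter_preP.
by rewrite -iter_tC; apply: stable_add js _ h => //; apply: layer_stable.
Qed.

Lemma lead_coefs_le W n1 n2 : stable [:: k] W -> (n1 <= n2)%N ->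
  ssub (lead_coefs W n1) (lead_coefs W n2).
Proof.
move=> kW /subnK<-; elim: (n2 - n1)%N => // j ih g /ih /lead_coefsP[Xg [w [l [Ww ll e]]]].
apply/lead_coefsP; split=> //; exists (t k w), (t k l).
by split; [apply: kW; rewrite ?mem_head|apply: layer_shift|rewrite /= e linearD].
Qed.

(** Subtracting an element of [Y] with the same leading coefficient lowers the degree. *)
Lemma lead_coefs_ssub W Y : ssub Y W -> (forall x, W x -> exists n, layer n x) ->
  (forall n, ssub (lead_coefs W n) (lead_coefs Y n)) -> ssub W Y.
Proof.
move=> YW Wl WY x Wx; have [n ln] := Wl x Wx.
elim: n x Wx ln => [|n ih] x Wx; first by move=> ->; apply: submod0.
move=> [l [_ [ll /iter_imgP[g Xg ->] e]]].
have /WY/lead_coefsP[_ [y [l' [Yy ll' e']]]] : lead_coefs W n g.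
  apply/lead_coefsP; split=> //; exists x, (- l).
  by split=> //; [apply: submodN|rewrite e addrAC subrr add0r].
rewrite -(subrK y x); apply: submodD => //; apply: ih.
  by apply: submodB => //; apply: YW.
by rewrite e e' addrCA addrAC subrr add0r; apply: submodD.
Qed.

Lemma noetherian_step W : (forall x, W x -> exists n, layer n x) ->
  noetherian_under (k :: s) W.
Proof.
move=> lW U UW kU.
have lU x : U x -> exists n, layer n x by move=> /UW/lW.
have sU : stable s U by apply: stable_sub kU => j js; rewrite inE js orbT.
have tU : stable [:: k] U by apply: stable_sub kU => j; rewrite !inE => ->.
have lle i j := @lead_coefs_le U i j tU.
have [Un UnE] := chain_union lle.
have [||Gn [GnU Gngen]] := nX (U := Un).
- by move=> x /UnE[n []].
- by move=> j js x /UnE[n h]; apply/UnE; exists n; apply: lead_coefs_stable js _ h.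
(* From [N] on the leading coefficients no longer grow, so generators lifted in degrees up to [N]
   suffice. *)
have [N hN] : exists N, forall g, g \in Gn -> lead_coefs U N g.
  by apply: (chain_union_seq lle) => g /GnU/UnE.
have lUN n : ssub (lead_coefs U n) (lead_coefs U N).
  apply: (@ssub_trans _ _ Un) => [x h|]; first by apply/UnE; exists n.
  by apply: Gngen => //; apply: lead_coefs_stable.
have lifts n : exists G, (forall g, g \in G -> U g) /\ forall Y, stable s Y ->
    (forall g, g \in G -> Y g) -> ssub Y U -> ssub (lead_coefs U n) (lead_coefs Y n).
  have [||G [GU Ggen]] := nX (U := lead_coefs U n); first by move=> x [].
    exact: lead_coefs_stable.
  have [|r [Gr rG]] := @seq_choice V V
    (fun g u => X g /\ U u /\ layer n (iter n (t k) g - u)) G.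
    move=> g /GU/lead_coefsP[Xg [w [l [Uw ll e]]]]; exists w; do 2!split=> //.
    by rewrite e addrAC subrr add0r.
  exists r; split=> [u /rG[g _ [_ []]] //|Y sY rY YU].
  apply: Ggen; first exact: lead_coefs_stable.
  move=> g /Gr[u ur [Xg [Uu h]]]; apply/lead_coefsP; split=> //.
  exists u, (iter n (t k) g - u); split=> //; first exact: rY.
  by rewrite addrCA subrr addr0.
have {lifts} [G hG] := choice lifts.
exists (flatten [seq G n | n <- iota 0 N.+1]); split.
  by move=> g /flatten_mapP[n _]; apply: (hG n).1.
(* [Y0] is cut down to [U] because the comparison of leading coefficients needs a submodule of
   [U]. *)
move=> Y0 sY0 GY0; pose Y := cap_submod Y0 U.
have YU : ssub Y U by move=> x [].
suff: ssub U Y by move=> h x /h[].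
have sY : stable s Y.
  by apply: stable_cap => //; apply: stable_sub sY0 => j js; rewrite inE js orbT.
have tY : stable [:: k] Y.
  by apply: stable_cap => //; apply: stable_sub sY0 => j; rewrite !inE => ->.
have low n : (n <= N)%N -> ssub (lead_coefs U n) (lead_coefs Y n).
  move=> nN; apply: (hG n).2 => // g gG; split; last exact: (hG n).1.
  by apply: GY0; apply/flatten_mapP; exists n; rewrite // mem_iota.
apply: lead_coefs_ssub => // n; case: (leqP n N) => [/low//|/ltnW Nn].
exact: ssub_trans (lUN n) (ssub_trans (low N (leqnn _)) (lead_coefs_le tY Nn)).
Qed.

End Step.

(** [X] is the module generated by [G] over [A[t_k : k in s]]: start from the span over [A] and
    take, for each operator, the union of the layers. *)
Lemma noetherian_hull s (G : seq V) : noetherian A ->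
  exists X, [/\ stable s X, forall g, g \in G -> X g & noetherian_under s X].
Proof.
move=> noeth; elim: s => [|k s [X [sX GX nX]]].
  elim: G => [|g G [X [_ GX nX]]].
    exists (zero_submod V); split=> // U U0 _; exists [::]; split=> // Y _ _ x /U0 ->.
    exact: submod0.
  exists (add_submod X (img_submod (scale_at g) (full_submod A^o))).
  split=> //; last exact: noetherian_add_span.
  move=> x; rewrite inE => /predU1P[->|/GX Xx]; last exact: ssub_addl.
  by apply: ssub_addr; exists 1 => //; apply/esym/scale1r.
have [W WE] := chain_union (@layer_le k X).
exists W; split.
- move=> j; rewrite inE => /predU1P[->|js] x /WE[n h]; apply/WE.
    by exists n.+1; apply: layer_shift.
  by exists n; apply: layer_stable js _ h.
- by move=> g /GX Xg; apply/WE; exists 1%N; apply: ssub_addr.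
- by apply: (noetherian_step sX nX) => x /WE.
Qed.

Lemma hilbert_basis s (G : seq V) : noetherian A ->
  generates s G (full_submod V) -> noetherian_under s (full_submod V).
Proof.
move=> noeth [_ gen]; have [X [sX GX nX]] := noetherian_hull s G noeth.
by move=> U _; apply: nX => x _; apply: gen.
Qed.

End HilbertBasis.

(** * Gradings *)

Section GradedModule.
Variables (A : idomainType) (V : lmodType A) (q : nat) (Mc : 'X_{1..q} -> submod V).
Hypothesis Mc_span : forall x : V, exists (s : seq 'X_{1..q}) (c : 'X_{1..q} -> V),
  (forall d, Mc d (c d)) /\ x = \sum_(d <- s) c d.
Hypothesis Mc_indep : forall (s : seq 'X_{1..q}) (c : 'X_{1..q} -> V),
  uniq s -> (forall d, Mc d (c d)) -> \sum_(d <- s) c d = 0 ->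
  forall d, d \in s -> c d = 0.
Implicit Types (c : 'X_{1..q} -> V) (d e : 'X_{1..q}).

Definition decomposes (x : V) c : Prop := (forall d, Mc d (c d)) /\
  exists s, [/\ uniq s, forall d, d \notin s -> c d = 0 & x = \sum_(d <- s) c d].

Lemma sum_support (s r : seq 'X_{1..q}) c : uniq s -> uniq r ->
  {subset s <= r} -> (forall d, d \notin s -> c d = 0) ->
  \sum_(d <- r) c d = \sum_(d <- s) c d.
Proof.
move=> us ur sr c0; rewrite (bigID (mem s)) /= [X in _ + X]big1 ?addr0 => [|d /c0 //].
rewrite -big_filter; apply: perm_big; apply: uniq_perm => // [|d].
  exact: filter_uniq.
by rewrite mem_filter andb_idr // => /sr.
Qed.

Lemma decomposesD x y c c' :
  decomposes x c -> decomposes y c' -> decomposes (x + y) (fun d => c d + c' d).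
Proof.
move=> [Mc_c [s [us cs ->]]] [Mc_c' [s' [us' cs' ->]]].
split=> [d|]; first exact: submodD.
exists (undup (s ++ s')); rewrite undup_uniq; split=> // [d|].
  by rewrite mem_undup mem_cat negb_or => /andP[/cs-> /cs'->]; rewrite addr0.
rewrite big_split /=; congr (_ + _); apply/esym/sum_support; rewrite ?undup_uniq //;
  by move=> d ds; rewrite mem_undup mem_cat ds ?orbT.
Qed.

Lemma decomposesZ a x c : decomposes x c -> decomposes (a *: x) (fun d => a *: c d).
Proof.
move=> [Mc_c [s [us cs ->]]]; split=> [d|]; first exact: submodZ.
by exists s; rewrite scaler_sumr; split=> // d /cs->; rewrite scaler0.
Qed.

Lemma decomposes1 d x : Mc d x -> decomposes x (fun e => if e == d then x else 0).
Proof.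
move=> Mx; split=> [e|]; first by case: eqP => [->|_] //; apply: submod0.
exists [:: d]; split=> // [e|]; first by rewrite inE => /negbTE->.
by rewrite big_seq1 eqxx.
Qed.

Lemma decomposes0 : decomposes 0 (fun=> 0).
Proof.
split=> [d|]; first exact: submod0.
by exists [::]; rewrite big_nil.
Qed.

Lemma decomposes_sum (I : eqType) (r : seq I) (F : I -> V) (C : I -> 'X_{1..q} -> V) :
  (forall i, i \in r -> decomposes (F i) (C i)) ->
  decomposes (\sum_(i <- r) F i) (fun d => \sum_(i <- r) C i d).
Proof.
elim: r => [|i r ih] h.
  rewrite big_nil (_ : (fun d => _) = fun=> 0); first exact: decomposes0.
  by apply/funext => d; rewrite big_nil.
rewrite big_cons (_ : (fun d => _) = fun d => C i d + \sum_(j <- r) C j d); last first.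
  by apply/funext => d; rewrite big_cons.
apply: decomposesD; first by apply: h; rewrite mem_head.
by apply: ih => j jr; apply: h; rewrite inE jr orbT.
Qed.

Lemma decomposes_unique x c c' : decomposes x c -> decomposes x c' -> c =1 c'.
Proof.
move=> xc /(decomposesZ (-1)) /(decomposesD xc); rewrite scaleN1r subrr.
move=> [Mcc [s [us cs /esym e]]] d; apply/eqP; rewrite -subr_eq0 -scaleN1r; apply/eqP.
by have [ds|/cs//] := boolP (d \in s); apply: (Mc_indep us Mcc).
Qed.

Lemma decomposes_ex x : exists c, decomposes x c.
Proof.
have [s [c [Mcc ->]]] := Mc_span x.
exists (fun e => \sum_(d <- s) (if e == d then c d else 0)).
apply: (@decomposes_sum _ s c (fun d e => if e == d then c d else 0)) => d _.
exact: decomposes1.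
Qed.

Definition proj d x : V := xget (fun=> 0) (decomposes x) d.

Lemma projP x : decomposes x (proj^~ x).
Proof.
exact: (xgetPex (fun=> 0) (decomposes_ex x)).
Qed.

Lemma proj_eq x c d : decomposes x c -> proj d x = c d.
Proof. by move=> /(decomposes_unique (projP x)). Qed.

Fact proj_is_linear d : linear (proj d).
Proof.
move=> a x y.
by rewrite (proj_eq d (decomposesD (decomposesZ a (projP x)) (projP y))).
Qed.
HB.instance Definition _ d :=
  GRing.isLinear.Build A V V *:%R (proj d) (proj_is_linear d).

Lemma proj_in d x : Mc d (proj d x).
Proof. exact: (projP x).1. Qed.

Lemma proj_id d x : Mc d x -> proj d x = x.
Proof. by move=> /decomposes1/(proj_eq d) ->; rewrite eqxx. Qed.

Lemma proj_other d e x : Mc d x -> e != d -> proj e x = 0.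
Proof. by move=> /decomposes1/(proj_eq e) -> /negbTE->. Qed.

Lemma proj_sum x : exists s, x = \sum_(d <- s) proj d x.
Proof. by have [_ [s [_ _]]] := projP x; exists s. Qed.

Lemma proj_shift (F : {linear V -> V}) e : (forall d x, Mc d x -> Mc (e + d)%MM (F x)) ->
  forall d x, proj d (F x) = if (e <= d)%MM then F (proj (d - e)%MM x) else 0.
Proof.
move=> FM d x; have [_ [s [us cs ex]]] := projP x.
apply: (@proj_eq _ (fun d => if (e <= d)%MM then F (proj (d - e)%MM x) else 0)).
split=> [{}d|].
  case: ifP => [ed|_]; last exact: submod0.
  by rewrite -{1}(submK ed) addmC; apply/FM/proj_in.
exists [seq (e + d)%MM | d <- s]; split.
- by rewrite map_inj_uniq // => d1 d2; rewrite ![(e + _)%MM]addmC; apply: addIm.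
- move=> {}d ds; case: ifP => // ed; rewrite cs ?linear0 //.
  apply: contra ds => ds; apply/mapP; exists (d - e)%MM => //.
  by rewrite addmC submK.
- rewrite {1}ex linear_sum big_map; apply: eq_bigr => d' _.
  by rewrite lem_addr [(e + d')%MM]addmC addmK.
Qed.

Section Families.
Variables (m : nat) (t : 'I_m -> {linear V -> V}) (dg : 'I_m -> 'X_{1..q}).
Implicit Types (U W Y : 'X_{1..q} -> submod V).

Definition fam_stable U : Prop :=
  forall k d x, U d x -> U (dg k + d)%MM (t k x).

Definition fam_ssub U W : Prop := forall d, ssub (U d) (W d).

Definition total U : submod V.
Proof.
exists (fun x => forall d, U d (proj d x)).
- by move=> d; rewrite linear0; apply: submod0.
- by move=> x y Ux Uy d; rewrite linearD; apply: submodD.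
- by move=> a x Ux d; rewrite linearZ; apply: submodZ.
Defined.

Lemma total_in U (UM : fam_ssub U Mc) d x : U d x -> total U x.
Proof.
move=> Ux e; have [->|ne] := eqVneq e d; first by rewrite proj_id //; apply: UM.
by rewrite (@proj_other d) //; [apply: submod0|apply: UM].
Qed.

Lemma total_stable U (UM : fam_ssub U Mc) s : fam_stable U ->
  stable t s (total U).
Proof.
move=> Ust k _ x Ux; have [r ->] := proj_sum x; rewrite linear_sum.
apply: submod_sum => d _; apply: (total_in UM (d := (dg k + d)%MM)).
exact/Ust/Ux.
Qed.

Definition fam_gen (G : seq ('X_{1..q} * V)) W : Prop :=
  (forall g, g \in G -> W g.1 g.2) /\
  forall Y, fam_stable Y -> (forall g, g \in G -> Y g.1 g.2) ->
    fam_ssub W Y.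

(** The homogeneous components of finitely many generators of [total W] generate the family. *)
Lemma fam_noetherian s : noetherian_under t s (full_submod V) ->
  forall W, fam_ssub W Mc -> fam_stable W -> exists G, fam_gen G W.
Proof.
move=> noeth W WM Wst.
have [|G [GW Ggen]] := noeth _ (@ssub_full _ _ (total W)); first exact: total_stable.
have [S hS] := choice proj_sum.
exists [seq (d, proj d g) | g <- G, d <- S g]; split.
  by move=> _ /allpairsPdep[g [d [gG _ ->]]]; apply: (GW g gG).
move=> Y0 Y0st GY0.
pose Y d := cap_submod (Y0 d) (W d).
have YM : fam_ssub Y Mc by move=> d x [_ /WM].
have Yst : fam_stable Y by move=> k d x [? ?]; split; [apply: Y0st|apply: Wst].
have WY : ssub (total W) (total Y).
  apply: Ggen; first exact: total_stable.
  move=> g gG; rewrite (hS g) big_seq; apply: submod_sum => d dS.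
  apply: (total_in YM (d := d)); split; last exact: (GW g gG).
  by apply: (GY0 (d, proj d g)); apply/allpairsPdep; exists g, d.
move=> d x Wx; have /WY/(_ d) := total_in WM Wx.
by rewrite proj_id => [[]|]; last exact: WM.
Qed.

End Families.

End GradedModule.

(** * Eventually polynomial functions *)

Section EventuallyPolynomial.
Variable q : nat.
Implicit Types (d e v : 'X_{1..q}) (L f h : 'X_{1..q} -> rat).

Lemma eventually_and (P Q : 'X_{1..q} -> Prop) :
  eventually P -> eventually Q -> eventually (fun d => P d /\ Q d).
Proof.
move=> [d0 hP] [d1 hQ]; exists (mlcm d0 d1) => d.
by rewrite lem_mlcm => /andP[/hP ? /hQ ?].
Qed.

Lemma eventually_imp (P Q : 'X_{1..q} -> Prop) :
  (forall d, P d -> Q d) -> eventually P -> eventually Q.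
Proof. by move=> PQ [d0 hP]; exists d0 => d /hP/PQ. Qed.

Lemma eventually_all (P : 'X_{1..q} -> Prop) : (forall d, P d) -> eventually P.
Proof. by move=> h; exists 0%MM => d _. Qed.

Lemma eventually_shift e (P : 'X_{1..q} -> Prop) :
  eventually P -> eventually (fun d => P (e + d)%MM).
Proof. by move=> [d0 h]; exists d0 => d dd; apply: h; apply: lepm_trans dd (lem_addl _ _). Qed.

Lemma eventually_unshift e (P : 'X_{1..q} -> Prop) :
  eventually (fun d => P (e + d)%MM) -> eventually P.
Proof.
move=> [d0 h]; exists (e + d0)%MM => d /mnm_lepP dd.
have ed : (e <= d)%MM.
  by apply/mnm_lepP => i; apply: leq_trans (dd i); rewrite mnmDE leq_addr.
rewrite -(submK ed) addmC; apply: h; apply/mnm_lepP => i.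
by have := dd i; rewrite mnmDE mnmBE; move: (e i) => j h; rewrite leq_subRL // (leq_trans (leq_addr _ _) h).
Qed.

Lemma mnm_ind (P : 'X_{1..q} -> Prop) :
  P 0%MM -> (forall i e, P e -> P (U_(i) + e)%MM) -> forall e, P e.
Proof.
move=> P0 PS e; have [k] := ubnP (mdeg e); elim: k e => // k ih e.
have [->|e0] := eqVneq e 0%MM; first by [].
have [i ei] : exists i, e i != 0%N.
  apply: contrapT => h; move/eqP: e0; apply; apply/mnmP => i; rewrite mnm0E.
  by apply/eqP; apply: contrapT => /negP ne; apply: h; exists i.
have le : (U_(i) <= e)%MM.
  by apply/mnm_lepP => j; rewrite mnm1E; case: eqP => // <-; rewrite lt0n.
rewrite -(submK le) addmC mdegD mdeg1 add1n ltnS => h; apply: PS; exact: ih.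
Qed.

Lemma mnm_addCA d e v : (d + (e + v) = e + (d + v))%MM.
Proof. by rewrite !addmA [(d + e)%MM]addmC. Qed.

Definition diff e L d : rat := L (e + d)%MM - L d.

(* [L] agrees, far enough, with a polynomial function of total degree [< k]. *)
Fixpoint evpoly k L : Prop :=
  if k is k'.+1 then forall p, evpoly k' (diff U_(p) L)
  else eventually (fun d => L d = 0).

Lemma evpoly_ext k L L' : eventually (fun d => L d = L' d) -> evpoly k L -> evpoly k L'.
Proof.
elim: k L L' => [|k ih] L L' e /=.
  move=> /(eventually_and e); apply: eventually_imp => d [-> //].
move=> h p; apply: ih (h p).
have := eventually_and e (eventually_shift U_(p) e); apply: eventually_imp => d [e1 e2].
by rewrite /diff e1 e2.
Qed.

Lemma evpolyD k L L' : evpoly k L -> evpoly k L' -> evpoly k (fun d => L d + L' d).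
Proof.
elim: k L L' => [|k ih] L L' /=.
  move=> h /(eventually_and h); apply: eventually_imp => d [-> ->]; exact: addr0.
move=> h h' p; apply: evpoly_ext (ih _ _ (h p) (h' p)).
by apply: eventually_all => d; rewrite /diff opprD addrACA.
Qed.

Lemma evpolyZ k a L : evpoly k L -> evpoly k (fun d => a * L d).
Proof.
elim: k L => [|k ih] L /=; first by apply: eventually_imp => d ->; rewrite mulr0.
move=> h p; apply: evpoly_ext (ih _ (h p)).
by apply: eventually_all => d; rewrite /diff mulrBr.
Qed.

Lemma evpolyB k L L' : evpoly k L -> evpoly k L' -> evpoly k (fun d => L d - L' d).
Proof.
move=> h /(evpolyZ (-1)) /(evpolyD h); apply: evpoly_ext.
by apply: eventually_all => d; rewrite mulN1r.
Qed.

Lemma evpoly0 k : evpoly k (fun=> 0).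
Proof.
elim: k => [|k ih] /=; first exact: eventually_all.
by move=> p; apply: evpoly_ext ih; apply: eventually_all => d; rewrite /diff subrr.
Qed.

Lemma evpoly_sum k (I : Type) (r : seq I) (F : I -> 'X_{1..q} -> rat) :
  (forall i, evpoly k (F i)) -> evpoly k (fun d => \sum_(i <- r) F i d).
Proof.
move=> h; elim: r => [|i r ih].
  by apply: evpoly_ext (evpoly0 k); apply: eventually_all => d; rewrite big_nil.
by apply: evpoly_ext (evpolyD (h i) ih); apply: eventually_all => d; rewrite big_cons.
Qed.

Lemma evpoly_shift k e L : evpoly k L -> evpoly k (fun d => L (e + d)%MM).
Proof.
elim: k L => [|k ih] L /=; first exact: eventually_shift.
move=> h p; apply: evpoly_ext (ih _ (h p)).
by apply: eventually_all => d; rewrite /diff mnm_addCA.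
Qed.

Lemma evpoly_unshift k e L : evpoly k (fun d => L (e + d)%MM) -> evpoly k L.
Proof.
elim: k L => [|k ih] L /=; first exact: eventually_unshift.
move=> h p; apply: ih; apply: evpoly_ext (h p).
by apply: eventually_all => d; rewrite /diff mnm_addCA.
Qed.

Lemma evpolyS k L : evpoly k L -> evpoly k.+1 L.
Proof.
elim: k L => [|k ih] L /=; last by move=> h p p'; apply: ih.
move=> h p; have := eventually_and h (eventually_shift U_(p) h).
by apply: eventually_imp => d [e1 e2]; rewrite /diff e1 e2 subrr.
Qed.

Lemma evpoly_le j k L : (j <= k)%N -> evpoly j L -> evpoly k L.
Proof. by move=> /subnK<-; elim: (k - j)%N => // i ih /ih/evpolyS. Qed.

Lemma evpoly_diff k e L : evpoly k.+1 L -> evpoly k (diff e L).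
Proof.
move=> h; elim/mnm_ind: e => [|p e ih].
  by apply: evpoly_ext (evpoly0 k); apply: eventually_all => d; rewrite /diff add0m subrr.
apply: evpoly_ext (evpolyD (evpoly_shift e (h p)) ih).
by apply: eventually_all => d; rewrite /diff addmA subrKA.
Qed.

(** Product rule: the difference of [d i * L d] is [d i] times that of [L], plus a shift of [L] when
    the direction is [i]. *)
Lemma evpolyX k i L : evpoly k L -> evpoly k.+1 (fun d => (d i)%:R * L d).
Proof.
elim: k L => [|k ih] L.
  by move=> h; apply: evpolyS; apply: eventually_imp h => d ->; rewrite mulr0.
move=> h p; have h1 := evpolyZ (i == p)%:R (evpoly_shift U_(p) h).
apply: evpoly_ext (evpolyD (ih _ (h p)) h1).
apply: eventually_all => d; rewrite /diff mnmDE mnm1E natrD eq_sym.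
ring.
Qed.

Lemma evpoly_mpolyX m k : (mdeg m < k)%N ->
  evpoly k (fun d => ('X_[m] : {mpoly rat[q]}).@[fun p => (d p)%:R]).
Proof.
elim/mnm_ind: m k => [|i m ih] k.
  rewrite mdeg0 => k0; apply: evpoly_le k0 _ => p.
  by apply: eventually_all => d; rewrite /diff !mpolyX0 !meval1 subrr.
case: k => // k; rewrite mdegD mdeg1 add1n ltnS => /ih/(evpolyX i).
apply: evpoly_ext; apply: eventually_all => d.
by rewrite mpolyXD mevalM mevalXU.
Qed.

Lemma evpoly_mpoly (H : {mpoly rat[q]}) :
  evpoly (msize H) (fun d => H.@[fun p => (d p)%:R]).
Proof.
(* [evpoly_sum] asks for the bound at every index, hence the test of membership in the support,
   where [mdeg m < msize H]. *)
have h : evpoly (msize H) (fun d => \sum_(m <- msupp H)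
    (if (m \in msupp H) then H@_m * ('X_[m] : {mpoly rat[q]}).@[fun p => (d p)%:R] else 0)).
  apply: (@evpoly_sum _ _ (msupp H) (fun m d => if m \in msupp H then
    H@_m * ('X_[m] : {mpoly rat[q]}).@[fun p => (d p)%:R] else 0)) => m.
  have [mH|_] := boolP (m \in msupp H); last exact: evpoly0.
  by apply/evpolyZ/evpoly_mpolyX; apply: msize_mdeg_lt.
apply: evpoly_ext h; apply: eventually_all => d.
rewrite [in RHS](mpolyE H) raddf_sum /= [RHS]big_seq [LHS]big_seq.
by apply: eq_bigr => m ->; rewrite mevalZ.
Qed.


(* The differences with step [m]: on a function of degree at most [k], [k] of
   them give [m ^ k] times the [k]-fold unit difference, so that a function of
   slower growth has a zero [k]-fold difference. *)
Definition diffs m (ps : seq 'I_q) f : 'X_{1..q} -> rat :=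
  foldl (fun g p => diff (U_(p) *+ m)%MM g) f ps.

Lemma evpolyP k f : evpoly k f <->
  forall ps, size ps = k -> eventually (fun d => diffs 1 ps f d = 0).
Proof.
elim: k f => [|k ih] f /=.
  split=> [h [|//] _ //|h]; exact: (h [::]).
split=> [h [//|p ps] /= [sz]|h p]; first by rewrite mulm1n; exact: (ih _).1.
by apply/ih => ps sz; have := h (p :: ps); rewrite /= mulm1n sz => /(_ erefl).
Qed.

Lemma diffs_sum m ps (I : Type) (r : seq I) (F : I -> 'X_{1..q} -> rat) d :
  diffs m ps (fun d => \sum_(i <- r) F i d) d = \sum_(i <- r) diffs m ps (F i) d.
Proof.
elim: ps F d => [|p ps ih] F d //=; rewrite -ih; congr (foldl _ _ _ _).
by apply/funext => e; rewrite /diff sumrB.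
Qed.

Lemma diffs_shift m ps e f d : diffs m ps (fun d => f (e + d)%MM) d = diffs m ps f (e + d)%MM.
Proof.
elim: ps f d => [|p ps ih] f d //=; rewrite -ih; congr (foldl _ _ _ _).
by apply/funext => e'; rewrite /diff mnm_addCA.
Qed.

Lemma diff_sum m e f d :
  diff (e *+ m)%MM f d = \sum_(j <- iota 0 m) diff e f (e *+ j + d)%MM.
Proof.
elim: m => [|m ih]; first by rewrite big_nil /diff mulm0n add0m subrr.
rewrite -[m.+1]addn1 iotaD big_cat big_seq1 -ih /diff add0n addn1 mulmS.
by rewrite [RHS]addrC -addmA subrKA.
Qed.

Lemma eventually_const f : evpoly 1 f -> exists d0, forall e d, (d0 <= d)%MM ->
  f (e + d)%MM = f d.
Proof.
move=> h; have {h} [d0 h] : eventually (fun d => forall p, diff U_(p) f d = 0).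
  suff : forall ps : seq 'I_q, eventually (fun d => forall p, p \in ps -> diff U_(p) f d = 0).
    by move=> /(_ (enum 'I_q)); apply: eventually_imp => d + p; apply; rewrite mem_enum.
  elim=> [|p ps ih]; first exact: eventually_all.
  have := eventually_and (h p) ih; apply: eventually_imp => d [e1 e2] p'.
  by rewrite inE => /predU1P[-> //|]; apply: e2.
exists d0 => e d dd; elim/mnm_ind: e => [|p e ih]; first by rewrite add0m.
rewrite -ih -addmA; apply/eqP; rewrite -subr_eq0; apply/eqP/h.
exact: lepm_trans dd (lem_addl _ _).
Qed.

(** A difference of step [m] is a sum of [m] shifted unit differences; the remaining differences
    make these eventually constant, so each direction contributes a factor [m]. *)
Lemma diffs_scale k f ps : size ps = k -> evpoly k.+1 f ->
  eventually (fun d => forall m, diffs m ps f d = m%:R ^+ k * diffs 1 ps f d).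
Proof.
elim: k f ps => [|k ih] f [|p ps] //=.
  by move=> _ _; apply: eventually_all => d m; rewrite expr0 mul1r.
move=> [sz] h; have hp := h p.
have [d1 h1] := ih _ _ sz hp.
have [d2 h2] : exists d0, forall e d, (d0 <= d)%MM ->
    diffs 1 ps (diff U_(p) f) (e + d)%MM = diffs 1 ps (diff U_(p) f) d.
  apply: eventually_const => p'.
  have := (evpolyP k.+1 _).1 hp (rcons ps p').
  by rewrite size_rcons sz /diffs foldl_rcons mulm1n => /(_ erefl).
exists (mlcm d1 d2) => d; rewrite lem_mlcm => /andP[dd1 dd2] m.
rewrite (_ : diff _ f = fun d => \sum_(j <- iota 0 m) diff U_(p) f (U_(p) *+ j + d)%MM).
  rewrite mulm1n -/(diffs m ps _) diffs_sum.
  under eq_bigr do rewrite (diffs_shift m ps _ (diff U_(p) f)).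
  under eq_bigr => j _ do rewrite h1 ?(lepm_trans dd1 (lem_addl _ _)) // h2 //.
  rewrite big_const_seq count_predT size_iota iter_addr_0 -[LHS]mulr_natl mulrA.
  by rewrite exprS.
by apply/funext => e; rewrite diff_sum.
Qed.

(** Telescoping along the ray reduces to [diff v h], of lower degree. The base of the power is
    [m.+1] because the bound must also hold at [m = 0]. *)
Lemma evpoly_growth k h v : evpoly k.+1 h -> eventually (fun d =>
  exists2 C : rat, 0 <= C & forall m, `|h (v *+ m + d)%MM| <= C * m.+1%:R ^+ k).
Proof.
elim: k h => [|k ih] h hp.
  have [d0 h0] := eventually_const hp; exists d0 => d dd.
  by exists `|h d|; rewrite ?normr_ge0 // => m; rewrite h0 // mulr1.
have [d0 h0] := ih _ (evpoly_diff v hp); exists d0 => d /h0[C C0 hC].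
exists (`|h d| + C) => [|m]; first by rewrite addr_ge0 ?normr_ge0.
have -> : h (v *+ m + d)%MM = h d + \sum_(j <- iota 0 m) diff v h (v *+ j + d)%MM.
  by rewrite -diff_sum /diff addrC subrK.
rewrite (le_trans (ler_normD _ _)) // mulrDl lerD //.
  by rewrite ler_peMr ?normr_ge0 // exprn_ege1 // ler1n.
apply: le_trans (ler_norm_sum _ _ _) _.
apply: le_trans (_ : \sum_(j <- iota 0 m) C * m.+1%:R ^+ k <= _).
  rewrite big_seq [leRHS]big_seq; apply: ler_sum => j; rewrite mem_iota => /andP[_ jm].
  apply: le_trans (hC j) _; apply: ler_wpM2l => //.
  by rewrite lerXn2r ?nnegrE ?ler0n // ler_nat ltnS ltnW.
rewrite big_const_seq count_predT size_iota iter_addr_0 -[leLHS]mulr_natr -mulrA.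
apply: ler_wpM2l => //; rewrite exprSr; apply: ler_wpM2l; first by rewrite exprn_ge0 ?ler0n.
by rewrite ler_nat.
Qed.

Lemma diffs_growth k f ps : (forall v, eventually (fun d =>
    exists2 C : rat, 0 <= C & forall m, `|f (v *+ m + d)%MM| <= C * m.+1%:R ^+ k)) ->
  eventually (fun d =>
    exists2 C : rat, 0 <= C & forall m, `|diffs m ps f d| <= C * m.+1%:R ^+ k).
Proof.
(* The function may depend on [m], since a difference of step [U_(p) *+ m] does; such a difference
   compares the rays of directions [v] and [U_(p) + v], so all directions are needed. *)
move=> hf; suff gen (F : nat -> 'X_{1..q} -> rat) : (forall v, eventually (fun d =>
      exists2 C : rat, 0 <= C & forall m, `|F m (v *+ m + d)%MM| <= C * m.+1%:R ^+ k)) ->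
    eventually (fun d => exists2 C : rat, 0 <= C &
      forall m, `|diffs m ps (F m) d| <= C * m.+1%:R ^+ k) by apply: (gen (fun=> f)).
move: F; elim: ps => [|p ps ih] F hF.
  have [d0 h] := hF 0%MM; exists d0 => d /h[C C0 hC]; exists C => // m.
  have := hC m; rewrite (_ : 0 *+ m + d = d)%MM //.
  by apply/mnmP => i; rewrite mnmDE mulmnE mnm0E.
apply: (ih (fun m => diff (U_(p) *+ m)%MM (F m))) => v.
have := eventually_and (hF v) (hF (U_(p) + v)%MM).
apply: eventually_imp => d [[C C0 hC] [C' C'0 hC']]; exists (C' + C) => [|m].
  exact: addr_ge0.
rewrite /diff addmA (_ : U_(p) *+ m + v *+ m = (U_(p) + v) *+ m)%MM; last first.
    by apply/mnmP => i; rewrite !(mulmnE, mnmDE) mulnDl.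
  rewrite mulrDl; apply: le_trans (ler_normB _ _) _.
exact: lerD.
Qed.

(** A nonzero top difference [c] of too high an order [k] would make a difference of step [m] equal
    to [m ^ k * c], more than the growth of [h] permits. So the degree of [f] is lowered until it
    meets that of [h]. *)
Lemma evpoly_squeeze k s f h : evpoly k f -> evpoly s h ->
  eventually (fun d => 0 <= f d <= h d) -> evpoly s f.
Proof.
case: s => [_|s].
  move=> /eventually_and hh /hh; apply: eventually_imp => d [-> /andP[? ?]].
  by apply/eqP; rewrite eq_le; apply/andP.
move=> fk hs fh; have fg v : eventually (fun d =>
    exists2 C : rat, 0 <= C & forall m, `|f (v *+ m + d)%MM| <= C * m.+1%:R ^+ s).
  have [d1 h1] := evpoly_growth v hs; have [d0 h0] := fh.
  exists (mlcm d0 d1) => d; rewrite lem_mlcm => /andP[dd0 /h1[C C0 hC]].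
  exists C => // m; apply: le_trans (hC m).
  have /h0/andP[f0 fhd] := lepm_trans dd0 (lem_addl (v *+ m)%MM d).
  by rewrite ger0_norm // (le_trans fhd) // ler_norm.
elim: k fk => [|k ih]; first exact: evpoly_le.
move=> fk; have [ks|sk] := leqP k s; first by apply: evpoly_le fk.
apply: ih; apply/evpolyP => ps sz.
have := eventually_and (diffs_scale sz fk) (diffs_growth ps fg).
apply: eventually_imp => d [hs' [C C0 hC]]; apply/eqP; rewrite -normr_eq0.
set c := diffs 1 ps f d in hs' *; apply: contrapT => /negP c0.
have {}c0 : 0 < `|c| by rewrite lt_def c0 normr_ge0.
(* For [m > 0], from [m.+1 <= 2 * m] and [s < k], the bound [m ^ k * |c| <= C * m.+1 ^ s] gives
   [m * |c| <= C * 2 ^ s], which this [m] violates. *)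
have [m] : exists m : nat, C * 2 ^+ s / `|c| < m%:R.
  exists (Num.Def.archi_bound (C * 2 ^+ s / `|c|)); apply: archi_boundP.
  by rewrite divr_ge0 // mulr_ge0 // exprn_ge0.
rewrite ltr_pdivrMr // ltNge => /negP; apply.
have [->|m0] := posnP m; first by rewrite mul0r mulr_ge0 // exprn_ge0.
have m0' : 0 < m%:R :> rat by rewrite ltr0n.
have := hC m; rewrite hs' normrM normrX normr_nat => hm.
rewrite -(ler_pM2l (exprn_gt0 s m0')) mulrA -exprSr.
apply: le_trans (_ : m%:R ^+ k * `|c| <= _).
  by apply: ler_wpM2r; rewrite ?normr_ge0 // ler_weXn2l // ler1n.
apply: le_trans hm _; rewrite mulrCA -exprMn; apply: ler_wpM2l => //.
rewrite lerXn2r ?nnegrE ?mulr_ge0 ?ler0n // mulr_natr mulr2n -natrD ler_nat.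
by rewrite -addn1 leq_add2l.
Qed.

End EventuallyPolynomial.

(** * Lengths of graded families *)

Section GradedFamilies.
Variables (A : idomainType) (V : lmodType A) (q : nat) (m : nat).
Variables (t : 'I_m -> {linear V -> V}) (tp : 'I_m -> 'I_q).
Hypothesis tC : forall i j x, t i (t j x) = t j (t i x).
Local Notation dg := (fun k => U_(tp k)%MM).
Local Notation fstable := (fam_stable t dg).
Implicit Types (U W Y : 'X_{1..q} -> submod V) (d e : 'X_{1..q}).

Definition fam_add U W d : submod V := add_submod (U d) (W d).
Definition fam_cap U W d : submod V := cap_submod (U d) (W d).

(** The guard is there because subtraction of multidegrees is truncated. *)
Definition fam_shift (F : {linear V -> V}) e W d : submod V :=
  if (e <= d)%MM then img_submod F (W (d - e)%MM) else zero_submod V.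

Definition fam_pre (F : {linear V -> V}) e U d : submod V :=
  pre_submod F (U (e + d)%MM).

Lemma fam_shiftE F e W d : fam_shift F e W (e + d)%MM = img_submod F (W d).
Proof. by rewrite /fam_shift lem_addr [(e + d)%MM]addmC addmK. Qed.

Lemma fam_add_stable U W : fstable U -> fstable W -> fstable (fam_add U W).
Proof.
move=> sU sW k d _ [u [w [Uu Ww ->]]]; exists (t k u), (t k w).
by rewrite linearD; split=> //; [apply: sU|apply: sW].
Qed.

Lemma fam_cap_stable U W : fstable U -> fstable W -> fstable (fam_cap U W).
Proof. by move=> sU sW k d x [Ux Wx]; split; [apply: sU|apply: sW]. Qed.

Lemma fam_shift_stable (F : {linear V -> V}) e W :
  (forall k x, t k (F x) = F (t k x)) -> fstable W -> fstable (fam_shift F e W).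
Proof.
move=> FC sW k d x; rewrite /fam_shift; case: ifP => [ed [w Ww ->]|_ ->]; last first.
  by rewrite linear0; apply: submod0.
rewrite (lepm_trans ed (lem_addl _ _)) FC; exists (t k w) => //.
rewrite (_ : (_ - e)%MM = (U_(tp k) + (d - e))%MM); first exact: sW.
apply/mnmP => i; rewrite !(mnmDE, mnmBE) addnBA //; exact: mnm_lepP.
Qed.

Lemma fam_pre_stable (F : {linear V -> V}) e U :
  (forall k x, t k (F x) = F (t k x)) -> fstable U -> fstable (fam_pre F e U).
Proof.
by move=> FC sU k d x Ux; rewrite /fam_pre /= -FC mnm_addCA; apply: sU.
Qed.

Variable Mc : 'X_{1..q} -> submod V.
Hypothesis noethM : forall W, fam_ssub W Mc -> fstable W ->
  exists G, fam_gen t dg G W.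

(** Induction on the total degree: [W d] is spanned by the family generators of degree [d] and the
    images under the [t j] of generators in degree [d - U_(tp j)]. *)
Lemma component_fin_gen W d : fam_ssub W Mc -> fstable W ->
  exists s : seq V, (forall x, x \in s -> W d x) /\
    forall Y : submod V, (forall x, x \in s -> Y x) -> ssub (W d) Y.
Proof.
move=> WM sW; have [G [GW Ggen]] := noethM WM sW.
have [k] := ubnP (mdeg d); elim: k d => // k ih d; rewrite ltnS => dk.
have /choice[S hS] : forall j, exists s : seq V, (U_(tp j) <= d)%MM ->
    (forall x, x \in s -> W (d - U_(tp j))%MM x) /\
    forall Y : submod V, (forall x, x \in s -> Y x) -> ssub (W (d - U_(tp j))%MM) Y.
  move=> j; have [le|nle] := boolP (U_(tp j) <= d)%MM; last by exists [::].
  have [|s hs] := ih (d - U_(tp j))%MM; last by exists s.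
  by move: dk; rewrite -{1}(submK le) mdegD mdeg1 addn1.
pose s1 := [seq g.2 | g <- G & g.1 == d].
pose s2 := [seq t j x | j <- [seq j <- enum 'I_m | (U_(tp j) <= d)%MM], x <- S j].
exists (s1 ++ s2); split=> [x|Y sY].
  rewrite mem_cat => /orP[/mapP[g + ->]|/allpairsPdep[j [y [+ yS ->]]]].
    by rewrite mem_filter => /andP[/eqP<- /GW].
  rewrite mem_filter => /andP[le _]; rewrite -{1}(submK le) addmC.
  by apply: sW; apply: (hS j le).1.
(* This test family differs from [W] in degree [d] only, so its stability amounts to [Y] containing
   the images from lower degrees. *)
pose F d' := if d' == d then cap_submod Y (W d) else W d'.
have FW d' : ssub (F d') (W d') by rewrite /F; case: eqP => [-> x []|_].
suff /(_ d) : fam_ssub W F by rewrite /F eqxx => h x /h[].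
apply: Ggen => [j d' x Fx|g gG]; last first.
  rewrite /F; case: eqP => [e|_]; last exact: GW.
  split; last by rewrite -e; apply: GW.
  apply: sY; rewrite mem_cat; apply/orP; left; apply/mapP; exists g => //.
  by rewrite mem_filter e eqxx.
rewrite /F; case: eqP => [e|_]; last exact/sW/FW.
split; last by rewrite -e; apply/sW/FW.
have le : (U_(tp j) <= d)%MM by rewrite -e lem_addr.
have ed : d' = (d - U_(tp j))%MM by rewrite -e addmC addmK.
have h : ssub (W (d - U_(tp j))%MM) (pre_submod (t j) Y).
  apply: (hS j le).2 => y yS; apply: sY; rewrite mem_cat; apply/orP; right.
  by apply/allpairsPdep; exists j, y; rewrite mem_filter le mem_enum.
by apply: h; rewrite -ed; apply: FW.
Qed.

(** A scalar that works for finitely many generators works in all degrees, since the [x] with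
    [a *: x] in [U d] form a stable family. *)
Lemma uniform_torsion U W : fam_ssub W Mc -> fstable W -> fstable U ->
  (forall d x, W d x -> exists2 s : A, s != 0 & U d (s *: x)) ->
  exists2 a : A, a != 0 & forall d x, W d x -> U d (a *: x).
Proof.
move=> WM sW sU tors; have [G [GW Ggen]] := noethM WM sW.
have [g gG|a a0 aG] := @common_denominator A _ G
  (fun g => pre_submod (scale_at g.2) (U g.1)).
  by have [b b0 bg] := tors _ _ (GW g gG); exists b.
exists a => // d x Wx.
apply: (Ggen (fun d => pre_submod (scale_by a) (U d)) _ aG d x Wx).
by move=> k e y Uy; rewrite /= /scale_by -linearZ; apply: sU.
Qed.

Section Length.
Variable p : primeid A.

Lemma fam_fin_len U W (a : A) d : noetherian A -> height_eq p 1 ->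
  fam_ssub W Mc -> fstable W -> fam_ssub U W -> a != 0 ->
  (forall x, W d x -> U d (a *: x)) -> fin_len p (U d) (W d).
Proof.
move=> noeth hp WM sW UW a0 aWU; have [s [sWd sgen]] := component_fin_gen d WM sW.
by apply: (torsion_fin_len noeth hp a0 aWU (UW d) sWd) => Y _; apply: sgen.
Qed.

(** Every operator of degree [U_(p0)] kills [W] modulo [U], so this quotient vanishes once the
    [p0]-degree reaches a bound exceeding that of all generators. *)
Lemma hilbert_serre_base (s : {set 'I_m}) (p0 : 'I_q) U W :
  fstable U -> fstable W -> fam_ssub W Mc -> fam_ssub U W ->
  (forall k, k \notin s -> forall d x, W d x -> U (U_(tp k) + d)%MM (t k x)) ->
  (forall k, k \in s -> tp k != p0) -> eventually (fun d => U d = W d).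
Proof.
move=> sU sW WM UW kills np0.
have [G [GW Ggen]] := noethM WM sW.
have [N hN] : exists N, forall g, g \in G -> (g.1 p0 < N)%N.
  elim: G {GW Ggen} => [|g G [N ih]]; first by exists 0%N.
  exists (maxn N (g.1 p0).+1) => h; rewrite inE => /predU1P[->|/ih hN].
    exact: leq_maxr.
  exact: leq_trans hN (leq_maxl _ _).
exists (U_(p0) *+ N)%MM => d /mnm_lepP /(_ p0).
rewrite mulmnE mnm1E eqxx mul1n => Nd; apply: submod_eq; first exact: UW.
pose Y d := if (d p0 < N)%N then W d else U d.
have UY d' : ssub (U d') (Y d') by rewrite /Y; case: ifP => _; [apply: UW|apply: ssub_refl].
suff /(_ d) : fam_ssub W Y by rewrite /Y ltnNge Nd.
apply: Ggen => [k d' x|g gG]; last by rewrite /Y hN //; apply: GW.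
rewrite {1}/Y; case: ifP => [lt Wx|_ Ux]; last exact/UY/sU.
have [ks|ks] := boolP (k \in s); last exact/UY/kills.
by rewrite /Y mnmDE mnm1E (negbTE (np0 k ks)) lt; apply: sW.
Qed.

(** Induction on the number of operators not yet known to kill the quotient. The difference in
    direction [p0] is the length of the cokernel minus that of the kernel of some [t k] of degree
    [U_(p0)], and [t k] kills both. *)
Lemma hilbert_serre (s : {set 'I_m}) U W : (0 < q)%N ->
  fstable U -> fstable W -> fam_ssub W Mc -> fam_ssub U W ->
  (forall d, fin_len p (U d) (W d)) ->
  (forall k, k \notin s -> forall d x, W d x -> U (U_(tp k) + d)%MM (t k x)) ->
  exists K, evpoly K (fun d => (len p (U d) (W d))%:R).
Proof.
move=> q0; have [n] := ubnP #|s|; elim: n s U W => // n ih s U W.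
rewrite ltnS => sn sU sW WM UW fl kills.
have [[p0 np0]|np] := EM (exists p0, forall k, k \in s -> tp k != p0).
  exists 0%N; have := hilbert_serre_base sU sW WM UW kills np0.
  by apply: eventually_imp => d ->; rewrite len_refl.
have {np} ex p0 : exists2 k, k \in s & tp k = p0.
  apply: contrapT => h; apply: np; exists p0 => k ks; apply/eqP => e.
  by apply: h; exists k.
suff : forall p0, exists K, evpoly K (diff U_(p0)%MM (fun d => (len p (U d) (W d))%:R)).
  move=> /choice[K hK]; exists (\sum_p0 K p0).+1%N => p0.
  by apply: evpoly_le (hK p0); rewrite (bigD1 p0) //= leq_addr.
move=> p0; have [k ks kp0] := ex p0.
have sk : (#|s :\ k| < n)%N by apply: leq_trans sn; rewrite (cardsD1 k s) ks.
have tkC j x : t j (t k x) = t k (t j x) by apply: tC.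
have sPre := fam_pre_stable (e := U_(p0)%MM) tkC sU.
have sShift := fam_shift_stable (e := U_(p0)%MM) tkC sW.
(* [Ker / U] is the kernel of [t k] on [W / U] and [W / Img] its cokernel. *)
pose Ker := fam_cap (fam_pre (t k) U_(p0)%MM U) W.
pose Img := fam_add (fam_shift (t k) U_(p0)%MM W) U.
have UKer : fam_ssub U Ker.
  by move=> d x Ux; split; [rewrite /= -kp0; apply: sU|apply: UW].
have KerW : fam_ssub Ker W by move=> d x [].
have UImg : fam_ssub U Img by move=> d; apply: ssub_addr.
have ImgW : fam_ssub Img W.
  move=> d; apply: add_ssub; last exact: UW.
  rewrite /fam_shift; case: ifP => [le _ [x Wx ->]|_ x ->]; last exact: submod0.
  by rewrite -(submK le) addmC -{1}kp0; apply: sW.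
have [|||d|j|K1 hK1] := ih (s :\ k) U Ker sk sU.
- exact: fam_cap_stable.
- by move=> d x /KerW/WM.
- exact: UKer.
- exact: fin_lenSl (UKer d) (KerW d) (fl d).
- rewrite in_setD1 negb_and negbK => /orP[/eqP-> d x [/=]|js d x [_ Wx]].
    by rewrite kp0.
  exact: kills.
have [||||d|j|K2 hK2] := ih (s :\ k) Img W sk.
- exact: fam_add_stable.
- exact: sW.
- exact: WM.
- exact: ImgW.
- exact: fin_lenSr (UImg d) (ImgW d) (fl d).
- rewrite in_setD1 negb_and negbK => /orP[/eqP-> d x Wx|js d x Wx].
    apply: ssub_addl; rewrite kp0 fam_shiftE; by exists x.
  by apply: ssub_addr; apply: kills.
exists (K1 + K2)%N.
have := evpolyB (evpoly_shift U_(p0)%MM (evpoly_le (leq_addl K1 K2) hK2))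
  (evpoly_le (leq_addr K2 K1) hK1).
apply: evpoly_ext; apply: eventually_all => d; rewrite /diff.
rewrite (len_add (UImg (U_(p0) + d)%MM) (ImgW _) (fl _)) (len_add (UKer d) (KerW d) (fl d)).
rewrite (_ : len p (U (U_(p0) + d)%MM) (Img _) = len p (Ker d) (W d)); last first.
  by rewrite /Img /fam_add fam_shiftE -len_iso.
rewrite !natrD; ring.
Qed.

End Length.

End GradedFamilies.

(** * Torsion and scalar quotients *)

Section TorsionClosure.
Variables (A : idomainType) (V : lmodType A).
Implicit Types U W Y : submod V.

Definition torsion_closure U W : submod V.
Proof.
exists (fun x => W x /\ exists2 s : A, s != 0 & U (s *: x)).
- by split; [apply: submod0|exists 1; rewrite ?oner_eq0 // scaler0; apply: submod0].
- move=> x y [Wx [s s0 Ux]] [Wy [r r0 Uy]]; split; first exact: submodD.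
  exists (r * s); first by rewrite mulf_neq0.
  by rewrite scalerDr -scalerA mulrC -[(s * r) *: y]scalerA; apply: submodD; apply: submodZ.
- move=> a x [Wx [s s0 Ux]]; split; first exact: submodZ.
  by exists s; rewrite // scalerA mulrC -scalerA; apply: submodZ.
Defined.

Lemma torsion_closure_ssub U W : ssub (torsion_closure U W) W.
Proof. by move=> x []. Qed.

Lemma ssub_torsion_closure U W : ssub U W -> ssub U (torsion_closure U W).
Proof.
by move=> UW x Ux; split; [apply: UW|exists 1; rewrite ?oner_eq0 // scale1r].
Qed.

Lemma torsion_closureZ U W (s : A) x : s != 0 -> W x ->
  torsion_closure U W (s *: x) -> torsion_closure U W x.
Proof.
move=> s0 Wx [_ [r r0 Ux]]; split=> //; exists (r * s); first by rewrite mulf_neq0.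
by rewrite -scalerA.
Qed.

Lemma is_len_torsion_closure U W : ssub U W ->
  is_len (zero_prime A) U (torsion_closure U W) 0.
Proof.
move=> UW; apply/is_len0P; first exact: ssub_torsion_closure.
by move=> x [_ [s /eqP s0 Ux]]; exists s.
Qed.

Lemma torsion_closure_full U W : is_len (zero_prime A) U W 0 ->
  torsion_closure U W = W.
Proof.
move=> l0; apply: submod_eq => [x []//|x Wx]; split=> //.
have /is_len0P h := loc_chain_ssub l0.1.
by have [s [/= /eqP s0 Us]] := (h (zero_prime A)).1 l0 x Wx; exists s.
Qed.

Definition fg U : Prop := exists s : seq V, (forall x, x \in s -> U x) /\
  forall Y, (forall x, x \in s -> Y x) -> ssub U Y.

Lemma fg_torsion U W : fg W -> is_len (zero_prime A) U W 0 ->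
  exists2 a : A, a != 0 & forall x, W x -> U (a *: x).
Proof.
move=> [s [sW sgen]] l0.
have [|a a0 aG] := @common_denominator A _ s (fun x => pre_submod (scale_at x) U).
  move=> x /sW Wx; have UW := loc_chain_ssub l0.1.
  by have [b [/eqP b0 Ub]] := (is_len0P _ UW).1 l0 x Wx; exists b.
by exists a => //; apply: (sgen (pre_submod (scale_by a) U)).
Qed.

End TorsionClosure.

Section SecondIsomorphism.
Variables (A : idomainType) (p : primeid A) (V : lmodType A).
Implicit Types U W : submod V.

Lemma img_idfun W : img_submod idfun W = W.
Proof. by apply: submod_eq => [_ [x Wx ->] //|x Wx]; exists x. Qed.

Lemma pre_idfun U : pre_submod idfun U = U.
Proof. exact: submod_eq. Qed.

Lemma is_len_cap U W k :
  is_len p (cap_submod U W) W k -> is_len p U (add_submod W U) k.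
Proof. by have := is_len_iso p idfun W U k; rewrite pre_idfun img_idfun => -[]. Qed.

Lemma len_cap U W : len p (cap_submod U W) W = len p U (add_submod W U).
Proof. by have := len_iso p idfun W U; rewrite pre_idfun img_idfun. Qed.

End SecondIsomorphism.

Section ScalarQuotient.
Variables (A : idomainType) (p : primeid A) (a : A).
Hypotheses (noeth : noetherian A) (ht1 : height_eq p 1) (a0 : a != 0).
Variables (V : lmodType A) (W : submod V).
Hypothesis fgW : forall Y, ssub Y W -> fg Y.
Local Notation scaled Y := (img_submod (scale_by a) Y).

Lemma scaled_ssub (Y : submod V) : ssub (scaled Y) Y.
Proof. by move=> _ [x Yx ->]; apply: submodZ. Qed.

(** The torsion-free [W / T] of rank [r] has, modulo [a], the length of a free module of that rank.
    Induction on [r]: the saturation [S] of [A x + T] splits off rank one and leaves [W / S]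
    torsion-free. *)
Lemma is_len_scalar_quotient r (T : submod V) : ssub T W ->
  (forall (s : A) x, s != 0 -> W x -> T (s *: x) -> T x) ->
  is_len (zero_prime A) T W r ->
  is_len p (add_submod (scaled W) T) W (r * len p (principal a) (full_submod A^o)).
Proof.
have ha : is_len p (principal a) (full_submod A^o) (len p (principal a) (full_submod A^o)).
  by apply: lenP => //; apply: ideal_fin_len => //; exists a => //; apply: principal_mem.
move: (len _ _ _) ha => c ha.
elim: r T => [|r ih] T TW Ttf lr.
  suff <- : T = W.
    rewrite (_ : add_submod _ _ = T); first exact: is_len_refl.
    apply: submod_eq; last exact: ssub_addr.
    by apply: add_ssub => //; apply: scaled_ssub.
  apply: submod_eq => // x Wx.
  by have [s [/eqP s0 /(Ttf _ _ s0 Wx)]] := (is_len0P _ TW).1 lr x Wx.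
have [x Wx nTx] : exists2 x, W x & ~ T x.
  apply: contrapT => h.
  suff e : T = W by move: lr; rewrite e => /(is_len_unique (is_len_refl _ _)).
  by apply: submod_eq => // x Wx; apply: contrapT => nTx; apply: h; exists x.
pose E := add_submod (img_submod (scale_at x) (full_submod A^o)) T.
have Ex : E x by apply: ssub_addl; exists 1 => //; apply/esym/scale1r.
have TE : ssub T E by apply: ssub_addr.
have EW : ssub E W by apply: add_ssub => // _ [b _ ->]; apply: submodZ.
pose S := torsion_closure E W.
have ES : ssub E S by apply: ssub_torsion_closure.
have SW : ssub S W by apply: torsion_closure_ssub.
have Stf (s : A) y : s != 0 -> W y -> S (s *: y) -> S y by apply: torsion_closureZ.
have colon0 (b : A) : T (b *: x) -> b = 0.
  by move=> Tbx; apply/eqP; apply: contrapT => /negP b0; apply/nTx/(Ttf b).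
have lE : is_len (zero_prime A) T E 1.
  apply: colon_len; rewrite (_ : pre_submod _ _ = zero_prime A); first exact: is_len_prime.
  by apply: submod_eq => [b /colon0|b ->]; last exact: submod0.
have lS : is_len (zero_prime A) T S 1.
  exact: is_len_add lE (is_len_torsion_closure EW).
have lSW : is_len (zero_prime A) S W r.
  have [k hk] := fin_len_ex SW (fin_lenSr (loc_chain_ssub lS.1) SW (is_len_fin lr)).
  by have := is_len_unique lr (is_len_add lS hk); rewrite add1n => -[->].
rewrite mulSn; apply: (is_len_add (Y := add_submod (scaled W) S)); last exact: ih.
have TS := ssub_trans TE ES.
(* There are two routes from [a E + T] to [S]: through [E] and through [a S + T]. Since [a] is
   injective modulo [T], [S / E] and [(a S + T) / (a E + T)] have equal lengths, hence so do the
   other two quotients. *)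
have l1 : is_len p (add_submod (scaled S) T) S c.
  pose B := add_submod (scaled E) T.
  have lBE : is_len p B E c.
    have := (is_len_iso p (scale_at x) (full_submod A^o) B c).1.
    rewrite (_ : cap_submod _ _ = principal a) => [/(_ ha)|].
      rewrite (_ : add_submod _ _ = E) //; apply: submod_eq.
        apply: add_ssub; first exact: ssub_addl.
        by apply: add_ssub => //; apply: scaled_ssub.
      apply: add_ssub; first exact: ssub_addl.
      by apply: ssub_trans (@ssub_addr _ _ _ _); apply: ssub_addr.
    apply: submod_eq.
      move=> b [[_ [t [[_ [_ [u [[d _ ->] Tu ->]]] ->] Tt e]]] _]; exists d => //.
      have {}e : b *: x = a *: (d *: x + u) + t by exact: e.
      suff e' : b = d * a by exact: e'.
      apply/eqP; rewrite -subr_eq0; apply/eqP/colon0.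
      rewrite scalerBl e scalerDr !scalerA [a * d]mulrC -addrA.
      rewrite [_ + a *: u]addrC -addrA [X in _ + X]addrC subrK.
      by apply: submodD => //; apply: submodZ.
    move=> _ [d _ ->]; split=> //; apply: ssub_addl.
    exists (d *: x); first by apply: ssub_addl; exists d.
    have e : ((d : A) * a) *: x = a *: ((d : A) *: x) by rewrite scalerA mulrC.
    exact: e.
  have BS : ssub B (add_submod (scaled S) T).
    apply: add_ssub; last exact: ssub_addr.
    by move=> _ [y /ES Sy ->]; apply: ssub_addl; exists y.
  have B'S : ssub (add_submod (scaled S) T) S.
    by apply: add_ssub => //; apply: scaled_ssub.
  have [b b0 bE] := fg_torsion (fgW SW) (is_len_torsion_closure EW).
  have [s [sS sgen]] := fgW SW.
  have flES : fin_len p E S.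
    by apply: (torsion_fin_len noeth ht1 b0 bE ES sS) => Y _; apply: sgen.
  have [k hk] := fin_len_ex ES flES.
  have hk' : is_len p B (add_submod (scaled S) T) k.
    have := (is_len_iso p (scale_by a) S B k).1.
    rewrite (_ : cap_submod _ _ = E) => [/(_ hk)|].
      rewrite (_ : add_submod (scaled S) B = add_submod (scaled S) T) //.
      apply: submod_eq; first by apply: add_ssub => //; apply: ssub_addl.
      apply: add_ssub; first exact: ssub_addl.
      by apply: ssub_trans (@ssub_addr _ _ _ _); apply: ssub_addr.
    apply: submod_eq; last first.
      by move=> y Ey; split; [apply: ssub_addl; exists y|apply: ES].
    move=> y [[_ [u [[e Ee ->] Tu eq]]] Sy].
    rewrite -(subrK e y); apply: submodD => //; apply: TE.
    apply: (Ttf a) => //; first by apply: submodB; [apply: SW|apply: EW].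
    by rewrite scalerBr -[a *: y]/(scale_by a y) eq addrC addKr.
  have lBS := is_len_add lBE hk.
  have flBS : fin_len p (add_submod (scaled S) T) S := fin_lenSr BS B'S (is_len_fin lBS).
  have [j hj] := fin_len_ex B'S flBS.
  have := is_len_unique lBS (is_len_add hk' hj); rewrite addnC => /addnI e.
  by rewrite e.
(* As [S] is saturated in [W], it meets [a W + T] in [a S + T]. *)
rewrite (_ : add_submod (scaled W) S = add_submod S (add_submod (scaled W) T)).
  apply: is_len_cap; rewrite (_ : cap_submod _ _ = add_submod (scaled S) T) //.
  apply: submod_eq => [_ [[_ [u [[w Ww ->] Tu ->]]] Sx]|y [_ [u [[w Sw ->] Tu ->]]]].
    exists (scale_by a w), u; split=> //; exists w => //.
    apply: (Stf a) => //; rewrite -[a *: w]/(scale_by a w) -(addrK u (scale_by a w)).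
    by apply: submodB => //; apply: TS.
  split; first by exists (scale_by a w), u; split=> //; exists w => //; apply: SW.
  by apply: submodD; [apply: submodZ|apply: TS].
apply: submod_eq.
  apply: add_ssub; last exact: ssub_addl.
  by apply: ssub_trans (@ssub_addr _ _ _ _); apply: ssub_addl.
apply: add_ssub; first exact: ssub_addr.
apply: add_ssub; first exact: ssub_addl.
by apply: ssub_trans TS (@ssub_addr _ _ _ _).
Qed.

End ScalarQuotient.

(** * Ranks *)

Section QuotientMap.
Variables (R : nzRingType) (V : lmodType R) (U : submod V).

Fact qpi_is_linear : linear (Defs.qpi U : V -> Defs.quot_type U).
Proof.
move=> a x y; have -> : a *: Defs.qpi U x = Defs.qpi U (a *: x) by exact: qpiZ.
exact/esym/qpiD.
Qed.
HB.instance Definition _ :=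
  GRing.isLinear.Build R V (Defs.quot_type U) *:%R (Defs.qpi U) qpi_is_linear.

Lemma qpi_eq0 x : Defs.qpi U x = 0 <-> U x.
Proof. by rewrite -(linear0 (Defs.qpi U)); split=> [/qpiP|Ux]; rewrite ?subr0 //; apply/qpiP; rewrite subr0. Qed.

End QuotientMap.

Section FreegLift.
Variables (R : nzRingType) (X : choiceType) (M : lmodType R) (f : X -> M).

Definition freeg_ext : {freeg X / R} -> M := fglift f.

Lemma freeg_extU c x : freeg_ext << c *g x >> = c *: f x.
Proof. exact: liftU. Qed.

Lemma freeg_scaleU c d x : c *: << d *g x >> = << c * d *g x >> :> {freeg X / R}.
Proof. by apply/eqP/freeg_eqP => y; rewrite coeffZ !coeffU mulrA. Qed.

HB.instance Definition _ := GRing.isZmodMorphism.Build {freeg X / R} M freeg_ext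
  (lift_is_additive _).

Fact freeg_ext_is_scalable : scalable freeg_ext.
Proof.
move=> c z; rewrite -(freeg_sumE z) scaler_sumr !raddf_sum.
by apply: eq_bigr => x _; rewrite /= freeg_scaleU !freeg_extU scalerA.
Qed.

HB.instance Definition _ := GRing.isScalable.Build R {freeg X / R} M *:%R freeg_ext
  freeg_ext_is_scalable.

End FreegLift.

Section TensorRank.
Variables (A : idomainType) (N : lmodType A).
Local Notation K := {fraction A}.
Local Notation "x %:F" := (tofrac x).
Local Notation T := (tensor_frac N).

Lemma frac_denom (x : K) : exists a s : A, s != 0 /\ s%:F * x = a%:F.
Proof.
elim/quotW: x => r; exists (frac r).1, (frac r).2; split; first exact: denom_ratioP.
unlock tofrac; apply/eqP; rewrite [_ * _]piE FracField.equivf_def.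
by rewrite /FracField.mulf !numden_Ratio ?mul1r ?oner_neq0 ?denom_ratioP // mulr1 mulrC.
Qed.

Definition denom_ideal (x : K) : submod A^o.
Proof.
exists (fun s => exists a : A, (s : A)%:F * x = a%:F).
- by exists 0; rewrite rmorph0 mul0r.
- by move=> s t [a ea] [b eb]; exists (a + b); rewrite !rmorphD /= mulrDl ea eb.
- move=> r s [a ea]; exists (r * a).
  by rewrite -[_ *: _]/((r : A) * (s : A)) !rmorphM /= -mulrA ea.
Defined.

Definition tensor1 (x : N) : T := Defs.qpi (gen_submod (@tensor_rel A N)) << x >>.

Lemma tensor1_linear (a : A) x y :
  tensor1 (a *: x + y) = a%:F *: tensor1 x + tensor1 y.
Proof.
have -> : a%:F *: tensor1 x + tensor1 y =
    Defs.qpi (gen_submod (@tensor_rel A N)) (a%:F *: << x >> + << y >>).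
  by rewrite linearP.
by apply/qpiP => U; apply; exists a, x, y.
Qed.

Lemma tensor1_0 : tensor1 0 = 0.
Proof.
have := tensor1_linear 1 0 0; rewrite scale1r addr0 tofrac1 scale1r => /eqP.
by rewrite -subr_eq0 opprD addrA subrr sub0r oppr_eq0 => /eqP.
Qed.

Lemma tensor1Z (a : A) x : tensor1 (a *: x) = a%:F *: tensor1 x.
Proof. by rewrite -[a *: x]addr0 tensor1_linear tensor1_0 addr0. Qed.

Lemma tensor1D x y : tensor1 (x + y) = tensor1 x + tensor1 y.
Proof. by rewrite -[x in LHS]scale1r tensor1_linear tofrac1 scale1r. Qed.

Lemma tensor1_sum (I : Type) (r : seq I) (F : I -> N) :
  tensor1 (\sum_(i <- r) F i) = \sum_(i <- r) tensor1 (F i).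
Proof. exact: (big_morph _ tensor1D tensor1_0). Qed.

Lemma tensor_denom (z : T) : exists s x, s != 0 /\ s%:F *: z = tensor1 x.
Proof.
elim/quot_ind: z => z; rewrite -(freeg_sumE z).
elim: (dom z) => [|x r [s [y [s0 e]]]].
  exists 1, 0; rewrite oner_eq0 big_nil tensor1_0; split=> //.
  by rewrite tofrac1 scale1r.
rewrite big_cons; have [a [d [d0 e']]] := frac_denom (coeff x z).
exists (s * d), ((s * a) *: x + d *: y); split; first by rewrite mulf_neq0.
rewrite linearD tensor1_linear tensor1Z scalerDr; congr (_ + _); last first.
  by rewrite mulrC tofracM -scalerA e.
rewrite -[X in << X *g _ >>]mulr1 -freeg_scaleU.
rewrite linearZ /= scalerA.
by rewrite !tofracM -mulrA e'.
Qed.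

Section Functional.
Variable phi : {linear N -> A^o}.

Definition frac_ext : {linear {freeg N / K} -> K^o} :=
  freeg_ext (fun y => (phi y : A)%:F : K^o).

Lemma frac_extU x : frac_ext << x >> = (phi x : A)%:F.
Proof. by rewrite /= freeg_extU scale1r. Qed.

(** [phi] extends to a linear form over [K] on the free space, and this form kills the defining
    relations. *)
Lemma tensor1_eq0 x : tensor1 x = 0 -> phi x = 0.
Proof.
move=> /qpi_eq0 /(_ (pre_submod frac_ext (zero_submod _))) h.
have : pre_submod frac_ext (zero_submod _) << x >>.
  apply: h => _ [a [y [z ->]]].
  rewrite /= -/(frac_ext _) linearB linearD linearZ !frac_extU linearP.
  by rewrite rmorphD rmorphM /= subrr.
by rewrite /= -/(frac_ext _) frac_extU => /eqP; rewrite tofrac_eq0 => /eqP.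
Qed.

End Functional.

Hypothesis separated : forall x : N, (forall phi : {linear N -> A^o}, phi x = 0) -> x = 0.

Lemma tensor1_inj0 x : tensor1 x = 0 -> x = 0.
Proof. by move=> x0; apply: separated => phi; apply: tensor1_eq0. Qed.

(** Clearing denominators in a basis gives independent [x i] in [N]; their spans form a chain of [k]
    steps isomorphic to [A], and [N] is torsion modulo the last span. *)
Lemma is_dim_rank k : is_dim T k ->
  is_len (zero_prime A) (zero_submod N) (full_submod N) k.
Proof.
move=> [b bP].
have /choice[sx hsx] : forall i, exists sx : A * N, sx.1 != 0 /\ sx.1%:F *: b i = tensor1 sx.2.
  by move=> i; have [s [x h]] := tensor_denom (b i); exists (s, x).
pose s i := (sx i).1; pose x i := (sx i).2.
have s0 i : s i != 0 := (hsx i).1.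
have bx i : (s i)%:F *: b i = tensor1 (x i) := (hsx i).2.
have indep (a : 'I_k -> A) : \sum_i a i *: x i = 0 -> forall i, a i = 0.
  move=> e i; have [c [_ cuniq]] := bP 0.
  have h1 : c = [ffun i => (a i * s i)%:F].
    apply: cuniq; rewrite -[LHS]tensor1_0 -[X in tensor1 X]e tensor1_sum; apply: eq_bigr => j _.
    by rewrite tensor1Z ffunE rmorphM -scalerA bx.
  have h2 : c = [ffun i => 0].
    by apply: cuniq; rewrite big1 // => j _; rewrite ffunE scale0r.
  have := congr1 (fun g : {ffun _ -> _} => g i) (etrans (esym h1) h2).
  by rewrite !ffunE => /eqP; rewrite tofrac_eq0 mulf_eq0 (negbTE (s0 i)) orbF => /eqP.
have [Y YE] : exists Y : nat -> submod N, forall j y, Y j y <->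
    exists2 a : 'I_k -> A, (forall i : 'I_k, (j <= i)%N -> a i = 0) & y = \sum_i a i *: x i.
  unshelve eexists (fun j => @Submod _ _ (fun y => exists2 a : 'I_k -> A,
    (forall i : 'I_k, (j <= i)%N -> a i = 0) & y = \sum_i a i *: x i) _ _ _) => //.
  - by exists (fun=> 0) => //; rewrite big1 // => i _; rewrite scale0r.
  - move=> _ _ [a a0 ->] [c c0 ->]; exists (fun i => a i + c i) => [i ji|].
      by rewrite a0 // c0 // addr0.
    by rewrite -big_split; apply: eq_bigr => i _; rewrite scalerDl.
  - move=> d _ [a a0 ->]; exists (fun i => d * a i) => [i ji|]; first by rewrite a0 // mulr0.
    by rewrite scaler_sumr; apply: eq_bigr => i _; rewrite scalerA.
have Y0 : Y 0%N = zero_submod N.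
  apply: submod_eq => [y /YE[a a0 ->]|y ->]; last exact: submod0.
  by rewrite /= big1 // => i _; rewrite a0 // scale0r.
have YS (j : 'I_k) : is_len (zero_prime A) (Y j) (Y j.+1) 1.
  rewrite (_ : Y j.+1 =
    add_submod (img_submod (scale_at (x j)) (full_submod A^o)) (Y j)).
    apply: colon_len; rewrite (_ : pre_submod _ _ = zero_prime A); first exact: is_len_prime.
    apply: submod_eq => [c|c ->]; last exact: submod0.
    move=> /YE[a a0 e] /=.
    have : \sum_i (a i - (if i == j then c else 0)) *: x i = 0.
      rewrite (eq_bigr (fun i => a i *: x i - (if i == j then c *: x j else 0))); last first.
        by move=> i _; rewrite scalerBl; case: eqP => [->|_] //; rewrite scale0r.
      rewrite sumrB -e -big_mkcond big_pred1_eq; exact: subrr.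
    by move=> /indep/(_ j); rewrite eqxx a0 // sub0r => /eqP; rewrite oppr_eq0 => /eqP.
  apply: submod_eq.
    move=> _ /YE[a a0 ->]; exists (a j *: x j), (\sum_(i | i != j) a i *: x i).
    split; first by exists (a j).
      apply/YE; exists (fun i => if i != j then a i else 0).
        move=> i ji; case: eqP => //= /eqP ne; apply: a0.
        by rewrite ltn_neqAle ji andbT eq_sym.
      by rewrite big_mkcond; apply: eq_bigr => i _; case: ifP; rewrite ?scale0r.
    by rewrite (bigD1 j).
  apply: add_ssub.
    move=> _ [c _ ->]; apply/YE; exists (fun i => if i == j then c else 0).
      by move=> i; case: eqP => [->|//]; rewrite ltnn.
    rewrite (eq_bigr (fun i => if i == j then c *: x j else 0)); last first.
      by move=> i _; case: eqP => [->|_] //; rewrite scale0r.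
    by rewrite -big_mkcond big_pred1_eq.
  by move=> y /YE[a a0 ->]; apply/YE; exists a => // i ji; apply: a0; apply: ltnW.
have Yk : is_len (zero_prime A) (Y k) (full_submod N) 0.
  apply/is_len0P => // y _; have [c [yc _]] := bP (tensor1 y).
  (* The coordinates of [tensor1 y] with respect to the [tensor1 (x i)] are [c i / s i]; [a] clears
     their denominators. *)
  have [|a a0 /(_ _ (mem_enum _ _)) hI] :=
    @common_denominator A _ (enum 'I_k) (fun i => denom_ideal (c i / (s i)%:F)).
    move=> i _; have [d [a [a0 e]]] := frac_denom (c i / (s i)%:F).
    by exists a => //; exists d.
  have /choice[d dE] := hI; exists a; split; first exact/eqP.
  apply/YE; exists d => [i|]; first by rewrite leqNgt ltn_ord.
  apply/eqP; rewrite -subr_eq0; apply/eqP/tensor1_inj0.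
  rewrite -scaleN1r tensor1D !tensor1Z yc tensor1_sum rmorphN1 scaleN1r scaler_sumr.
  apply/eqP; rewrite subr_eq0; apply/eqP/eq_bigr => i _.
  rewrite tensor1Z -bx !scalerA; congr (_ *: _).
  by rewrite -dE -mulrA mulfVK // tofrac_eq0.
suff Yj j : (j <= k)%N -> is_len (zero_prime A) (zero_submod N) (Y j) j.
  by have := is_len_add (Yj k (leqnn k)) Yk; rewrite addn0.
elim: j => [|j ih] jk; first by rewrite Y0; apply: is_len_refl.
by have := is_len_add (ih (ltnW jk)) (YS (Ordinal jk)); rewrite addn1.
Qed.

End TensorRank.

(** The surjection onto [V] from the free module on its elements splits, and the coordinates of the
    splitting are functionals. *)
Lemma projective_separated (A : idomainType) (V : lmodType A) : projective V ->
  forall x : V, (forall phi : {linear V -> A^o}, phi x = 0) -> x = 0.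
Proof.
move=> proj x phi0; pose ev : {linear {freeg V / A} -> V} := freeg_ext id.
have [|l hl] := proj _ _ ev (idfun : {linear V -> V}).
  by move=> y; exists << y >>; rewrite /= freeg_extU scale1r.
have <- : ev (l x) = x by exact: hl.
suff -> : l x = 0 by exact: linear0.
apply/eqP/freeg_eqP => y; rewrite coeff0.
exact: (phi0 (freeg_ext (fun z => (z == y)%:R : A^o) \o l)).
Qed.

Lemma projective_torsion_free (A : idomainType) (V : lmodType A) : projective V ->
  forall (s : A) (x : V), s != 0 -> s *: x = 0 -> x = 0.
Proof.
move=> proj s x s0 sx0; apply: projective_separated => // phi.
have : (s : A) * (phi x : A) = 0.
  have := linearZ_LR phi s x; rewrite sx0 linear0 => e; exact: esym e.
by move/eqP; rewrite mulf_eq0 (negbTE s0) => /eqP.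
Qed.

(** * Reduction by a filter-regular element *)

Lemma len_le (A : idomainType) (p : primeid A) (V : lmodType A) (U U' W' W : submod V) :
  ssub U U' -> ssub U' W' -> ssub W' W -> fin_len p U W ->
  (len p U' W' <= len p U W)%N.
Proof.
move=> UU' U'W' W'W fl; have U'W := ssub_trans U'W' W'W.
rewrite (len_add UU' U'W fl) (len_add U'W' W'W (fin_lenSr UU' U'W fl)).
by rewrite addnCA leq_addr.
Qed.

Section Reduction.
Variables (A : idomainType) (V : lmodType A) (q : nat) (m : nat).
Variables (t : 'I_m -> {linear V -> V}) (tp : 'I_m -> 'I_q).
Hypothesis tC : forall i j x, t i (t j x) = t j (t i x).
Local Notation dg := (fun k => U_(tp k)%MM).
Local Notation fstable := (fam_stable t dg).
Variable Mc : 'X_{1..q} -> submod V.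
Hypotheses (q0 : (0 < q)%N) (noeth : noetherian A).
Hypothesis noethM : forall W, fam_ssub W Mc -> fstable W ->
  exists G, fam_gen t dg G W.
Hypothesis sM : fstable Mc.
Implicit Types (B U W : 'X_{1..q} -> submod V) (d e : 'X_{1..q}).

Local Notation gen := (zero_prime A).
Local Notation rank B d := (len gen (B d) (Mc d)).

Definition torsion_part B d : submod V := torsion_closure (B d) (Mc d).

Lemma torsion_part_stable B : fstable B -> fstable (torsion_part B).
Proof.
move=> sB k d x [Mx [s s0 Bx]]; split; first exact: sM.
by exists s; rewrite // -linearZ; apply: sB.
Qed.

Lemma torsion_part_uniform B : fstable B ->
  exists2 a : A, a != 0 & forall d x, torsion_part B d x -> B d (a *: x).
Proof.
move=> sB; apply: (uniform_torsion noethM) => //.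
- by move=> d; apply: torsion_closure_ssub.
- exact: torsion_part_stable.
by move=> d x [_ []] s s0 Bx; exists s.
Qed.

Lemma component_noetherian d (Y : submod V) : ssub Y (Mc d) -> fg Y.
Proof.
move=> YM; have [s [sM' sgen]] := component_fin_gen noethM d (fun d => @ssub_refl _ _ (Mc d)) sM.
have [X [_ sX nX]] := noetherian_hull tC [::] s noeth.
have [||G [GY Ggen]] := nX Y => //.
  by apply: ssub_trans YM _; apply: sgen.
by exists G; split=> // Z GZ; apply: Ggen.
Qed.

(* The degree of the rank of [M / B] is less than [n], that of the length of its
   torsion at every height-one prime at most [n]. *)
Definition bounded n B : Prop :=
  [/\ eventually (fun d => fin_len gen (B d) (Mc d)),
      evpoly n (fun d => (rank B d)%:R) &
      forall p, height_eq p 1 -> evpoly n.+1 (fun d => (len p (B d) (torsion_part B d))%:R)].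

Section Step.
Variables (F : {linear V -> V}) (e : 'X_{1..q}) (B B' : 'X_{1..q} -> submod V).
Hypothesis FM : forall d x, Mc d x -> Mc (e + d)%MM (F x).
Hypothesis FB : forall d x, B d x -> B (e + d)%MM (F x).
Hypotheses (sB : fstable B) (sB' : fstable B') (BB' : fam_ssub B B') (B'M : fam_ssub B' Mc).
Hypothesis B'E : forall d, B' (e + d)%MM = add_submod (img_submod F (Mc d)) (B (e + d)%MM).
Hypothesis regular :
  eventually (fun d => forall x, Mc d x -> B (e + d)%MM (F x) -> B d x).

(** Regularity makes [F] injective modulo [B] in degree [d], so [Y / B d] is isomorphic to its
    image. *)
Lemma len_regular p (Y : submod V) d : ssub (B d) Y -> ssub Y (Mc d) ->
  (forall x, Mc d x -> B (e + d)%MM (F x) -> B d x) ->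
  len p (B (e + d)%MM) (add_submod (img_submod F Y) (B (e + d)%MM)) = len p (B d) Y.
Proof.
move=> BY YM reg; rewrite -len_iso; congr (len _ _ _); apply: submod_eq.
  by move=> x [/= Bx /YM Mx]; apply: reg.
by move=> x Bx; split; [apply: FB|apply: BY].
Qed.

Let BM : fam_ssub B Mc. Proof. by move=> d x /BB'/B'M. Qed.

Lemma rank_step : eventually (fun d => fin_len gen (B d) (Mc d)) ->
  eventually (fun d => (rank B' (e + d)%MM)%:R = diff e (fun d => (rank B d)%:R) d :> rat).
Proof.
move=> fl; have := eventually_and regular (eventually_shift e fl).
apply: eventually_imp => d [reg fld]; rewrite /diff.
rewrite (len_add (@BB' (e + d)%MM) (@B'M _) fld) natrD {2}B'E len_regular //.
by rewrite addrAC subrr add0r.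
Qed.

Lemma torsion_step p : height_eq p 1 -> eventually (fun d =>
  (len p (B' (e + d)%MM) (torsion_part B' (e + d)%MM))%:R =
  diff e (fun d => (len p (B d) (torsion_part B d))%:R) d +
  (len p (add_submod (torsion_part B (e + d)%MM) (B' (e + d)%MM))
     (torsion_part B' (e + d)%MM))%:R :> rat).
Proof.
move=> hp; have [a a0 aB] := torsion_part_uniform sB; have [a' a'0 aB'] := torsion_part_uniform sB'.
apply: eventually_imp regular => d reg; rewrite /diff; set D := (e + d)%MM.
have BT d' : ssub (B d') (torsion_part B d') by apply/ssub_torsion_closure/BM.
have TM d' : ssub (torsion_part B d') (Mc d') by apply: torsion_closure_ssub.
have BT' d' : ssub (B' d') (torsion_part B' d') by apply/ssub_torsion_closure/B'M.
have TM' d' : ssub (torsion_part B' d') (Mc d') by apply: torsion_closure_ssub.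
have TT' : ssub (torsion_part B D) (torsion_part B' D).
  by move=> x [Mx [s s0 /BB' Bx]]; split=> //; exists s.
have flB : fin_len p (B D) (torsion_part B D).
  exact: (@fam_fin_len _ _ _ _ _ _ _ noethM p B _ a D noeth hp TM (torsion_part_stable sB) BT a0 (@aB D)).
have flB' : fin_len p (B' D) (torsion_part B' D).
  exact: (@fam_fin_len _ _ _ _ _ _ _ noethM p B' _ a' D noeth hp TM' (torsion_part_stable sB') BT' a'0 (@aB' D)).
rewrite (len_add (@ssub_addr _ _ (torsion_part B D) (B' D)) (add_ssub TT' (BT' D)) flB').
rewrite -len_cap natrD; congr (_ + _).
(* If [s] kills [F y + b] modulo [B], then [F (s *: y)] lies in [B], so [y] is torsion by
   regularity: the old torsion inside [B'] comes from the torsion in degree [d]. *)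
have capE : cap_submod (B' D) (torsion_part B D) =
    add_submod (img_submod F (torsion_part B d)) (B D).
  rewrite B'E -/D; apply: submod_eq => [x [[_ [b [[y My ->] Bb ->]]] [_ [s s0 Bx]]]|].
    exists (F y), b; split=> //; exists y => //; split=> //; exists s => //.
    apply: reg; first exact: submodZ.
    rewrite linearZ /= -[s *: F y](addrK (s *: b)) -scalerDr.
    by apply: submodB => //; apply: submodZ.
  apply: add_ssub => [_ [y [My [s s0 By]] ->]|x Bx]; last first.
    by split; [apply: ssub_addr|apply: BT].
  split; first by apply: ssub_addl; exists y.
  by split; [apply: FM|exists s; rewrite // -linearZ; apply: FB].
have BC : ssub (B D) (cap_submod (B' D) (torsion_part B D)).
  by rewrite capE; apply: ssub_addr.
have CT : ssub (cap_submod (B' D) (torsion_part B D)) (torsion_part B D) by move=> x [].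
rewrite (len_add BC CT flB) natrD {2}capE len_regular //.
by rewrite addrAC subrr add0r.
Qed.

(** The constant is the length of [A] modulo a scalar killing the torsion of [M / B'] in all degrees
    at once, hence independent of [d]. *)
Lemma excess_le p : height_eq p 1 -> exists c : nat, forall d, fin_len gen (B d) (Mc d) ->
  (len p (add_submod (torsion_part B d) (B' d)) (torsion_part B' d) <= rank B d * c)%N.
Proof.
move=> hp; have [a a0 aB'] := torsion_part_uniform sB'.
exists (len p (principal a) (full_submod A^o)) => d fl.
set T := torsion_part B d; set T' := torsion_part B' d; set Y := add_submod T (B' d).
have TM : ssub T (Mc d) by apply: torsion_closure_ssub.
have BT : ssub (B d) T by apply/ssub_torsion_closure/BM.
have TM' : ssub T' (Mc d) by apply: torsion_closure_ssub.
have lT : is_len gen T (Mc d) (rank B d).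
  have [k hk] := fin_len_ex TM (fin_lenSr BT TM fl).
  have := is_len_add (is_len_torsion_closure (@BM d)) hk.
  by rewrite add0n => /len_eq ->.
have := is_len_scalar_quotient noeth hp a0 (@component_noetherian d) TM _ lT.
set aM := img_submod _ _; move=> /(_ _)[|c1 c2]; first by move=> s x; apply: torsion_closureZ.
have lc := conj c1 c2 : is_len _ _ _ _.
rewrite -(len_eq lc).
pose G := add_submod aM Y.
have aMM : ssub aM (Mc d) by apply: scaled_ssub.
have TT' : ssub T T' by move=> x [Mx [s s0 /BB' Bx]]; split=> //; exists s.
(* If [a w + y] lies in [T'], so does [w], because [T'] is saturated, and then [a w] lies in [B'].
   Hence [T' / Y] embeds into [M / (a M + Y)], a quotient of [M / (a M + T)]. *)
have -> : Y = cap_submod G T'.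
  apply: submod_eq => [x Yx|x [[_ [y [[w Mw ->] Yy ->]]] Tx]].
    split; first exact: ssub_addr.
    move: x Yx; apply: add_ssub => //; exact/ssub_torsion_closure/B'M.
  apply: submodD => //; apply: ssub_addr; apply: aB'.
  apply: (torsion_closureZ a0 Mw); rewrite -[a *: w]/(scale_by a w) -(addrK y (scale_by a w)).
  apply: submodB => //; move: y Yy {Tx}; apply: add_ssub => //.
  exact/ssub_torsion_closure/B'M.
rewrite len_cap; apply: len_le (is_len_fin lc).
- by apply: add_ssub; [apply: ssub_addl|move=> x Tx; apply/ssub_addr/ssub_addl].
- exact: ssub_addr.
- apply: add_ssub => //; apply: add_ssub => //.
  by apply: add_ssub => //; apply: B'M.
Qed.

(** Both contributions to the new torsion length have degree at most [n]: the difference of the old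
    one, of degree at most [n.+1], and the excess, bounded by a multiple of the old rank. *)
Lemma bounded_step n : bounded n.+1 B -> bounded n B'.
Proof.
move=> [fl rk tors]; split.
- by apply: eventually_imp fl => d; apply: fin_lenSr (@BB' d) (@B'M d).
- apply: (evpoly_unshift (e := e)); apply: evpoly_ext (evpoly_diff e rk).
  by apply: eventually_imp (rank_step fl) => d ->.
move=> p hp; apply: (evpoly_unshift (e := e)).
have /evpoly_ext : eventually (fun d => diff e (fun d => (len p (B d) (torsion_part B d))%:R) d +
  (len p (add_submod (torsion_part B (e + d)%MM) (B' (e + d)%MM))
     (torsion_part B' (e + d)%MM))%:R =
  (len p (B' (e + d)%MM) (torsion_part B' (e + d)%MM))%:R :> rat).
  by apply: eventually_imp (torsion_step hp) => d ->.
apply; apply: evpolyD; first exact/evpoly_diff/tors.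
apply: (@evpoly_shift _ n.+1 e
  (fun d => (len p (add_submod (torsion_part B d) (B' d)) (torsion_part B' d))%:R)).
have [c hc] := excess_le hp.
pose Y := fam_add (torsion_part B) B'.
have sY : fstable Y by apply: fam_add_stable => //; apply: torsion_part_stable.
have YT : fam_ssub Y (torsion_part B').
  move=> d; apply: add_ssub; last exact/ssub_torsion_closure/B'M.
  by move=> x [Mx [s s0 /BB' Bx]]; split=> //; exists s.
have TM : fam_ssub (torsion_part B') Mc by move=> d; apply: torsion_closure_ssub.
have [a a0 aB'] := torsion_part_uniform sB'.
have flY d : fin_len p (Y d) (torsion_part B' d).
  apply: (@fam_fin_len _ _ _ _ _ _ _ noethM p Y _ a d noeth hp TM (torsion_part_stable sB') YT a0).
  by move=> x /aB' Bx; apply: ssub_addr.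
(* The degree bound [K] is arbitrary here; the squeeze against the rank brings it down. *)
have [|K hK] := hilbert_serre tC noethM (s := finset.setTfor 'I_m) q0 sY
    (torsion_part_stable sB') TM YT flY.
  by move=> k; rewrite finset.in_setT.
apply: evpoly_squeeze hK (evpolyZ c%:R rk) _.
by apply: eventually_imp fl => d /hc h; rewrite ler0n /= -natrM ler_nat mulnC.
Qed.

End Step.

(** Each prime comes with its own threshold. A common one exists because only the finitely many
    primes containing [a] need theirs; at the others the length is already zero. *)
Lemma bounded0_eventually B : fstable B -> fam_ssub B Mc -> bounded 0 B ->
  exists nu0 : 'X_{1..q}, (exists2 a : A, a != 0 &
      forall nu, (nu0 <= nu)%MM -> forall x, Mc nu x -> B nu (a *: x)) /\
    forall p : ht1prime A, forall nu, (nu0 <= nu)%MM ->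
      len (val p) (B nu) (Mc nu) = len (val p) (B nu0) (Mc nu0).
Proof.
move=> sB BM [fl rk tors].
have [d0 hd0] : eventually (fun d => torsion_part B d = Mc d).
  have := eventually_and fl rk; apply: eventually_imp => d [fld /eqP].
  rewrite pnatr_eq0 => /eqP r0; apply: torsion_closure_full.
  by rewrite -r0; apply: lenP => //; apply: BM.
have [a a0 aB] := torsion_part_uniform sB.
have aM nu : (d0 <= nu)%MM -> forall x, Mc nu x -> B nu (a *: x).
  by move=> le x; rewrite -(hd0 nu le); apply: aB.
have [|s hs] := ht1primes_over noeth (I := principal a).
  by exists a => //; apply: principal_mem.
have [d1 hd1] : eventually (fun d => forall p, p \in s -> forall e,
    len (val p) (B (e + d)%MM) (Mc (e + d)%MM) = len (val p) (B d) (Mc d)).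
  elim: s {hs} => [|p s ih]; first exact: eventually_all.
  have [d2 hd2] := eventually_const (tors (val p) (asboolW (valP p))).
  have : eventually (fun d => forall e,
      len (val p) (B (e + d)%MM) (Mc (e + d)%MM) = len (val p) (B d) (Mc d)).
    exists (mlcm d0 d2) => d; rewrite lem_mlcm => /andP[dd0 dd2] e.
    have := hd2 e d dd2; rewrite !hd0 ?(lepm_trans dd0 (lem_addl _ _)) //.
    by move/eqP; rewrite eqr_nat => /eqP.
  move=> /(eventually_and ih); apply: eventually_imp => d [h1 h2] p'.
  by rewrite inE => /predU1P[->|/h1].
exists (mlcm d0 d1); split.
  by exists a => // nu; rewrite lem_mlcm => /andP[/aM].
move=> p nu le; have [ps|ps] := boolP (p \in s).
  rewrite -(submK le); apply: hd1 => //; exact: lem_mlcmr.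
have npa : ~ val p a.
  move=> pa; move/negP: ps; apply; apply: hs => _ [b _ ->]; exact: ideal_mull.
have len0 d : (d0 <= d)%MM -> len (val p) (B d) (Mc d) = 0%N.
  move=> dd; apply: len_eq; apply/is_len0P; first exact: BM.
  by move=> x Mx; exists a; split=> //; apply: aM.
have le0 := lem_mlcml d0 d1.
by rewrite !len0 // (lepm_trans le0 le).
Qed.

End Reduction.

(** * Multigraded modules *)

Section SubmoduleLength.
Variables (A : idomainType) (p : primeid A) (V : lmodType A) (U : submod V).

Definition submod_val : {linear submod_type U -> V} := val.

Lemma is_len_submod_type k :
  is_len p (zero_submod (submod_type U)) (full_submod (submod_type U)) k <->
  is_len p (zero_submod V) U k.
Proof.
have := is_len_iso p submod_val (full_submod (submod_type U)) (zero_submod V) k.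
rewrite (_ : cap_submod _ _ = zero_submod (submod_type U)); last first.
  apply: submod_eq => [x [x0 _]|x ->]; last by split=> //; apply: submod0.
  by apply: val_inj; rewrite [LHS]x0 linear0.
rewrite (_ : add_submod _ _ = U) //; apply: submod_eq.
  apply: add_ssub; last exact: zero_ssub.
  by move=> _ [[x Ux] _ ->]; apply: asboolW.
move=> x Ux; apply: ssub_addl; exists (exist _ x (asboolT Ux)) => //.
Qed.

End SubmoduleLength.

Section Multigraded.
Variables (A : idomainType) (q : nat) (n : 'I_q -> nat) (M : mgmod A n).
Local Notation m := (\sum_p (n p).+1)%N.
Local Notation V := (restr M).
Local Notation Mc := (mg_submod M).
Implicit Types (d e : 'X_{1..q}) (f g : mring A n).

Definition act f (x : V) : V := f *: (x : M).

Fact act_is_linear f : linear (act f).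
Proof.
move=> a x y; rewrite /act scalerDr; congr (_ + _).
have e : f *: (a%:MP *: (x : M)) = a%:MP *: (f *: (x : M)) by rewrite !scalerA mulrC.
exact: e.
Qed.
HB.instance Definition _ f := GRing.isLinear.Build A V V *:%R (act f) (act_is_linear f).

Lemma actC f g x : act f (act g x) = act g (act f x).
Proof. by rewrite /act !scalerA mulrC. Qed.

Local Notation t := (fun k : 'I_m => act 'X_k : {linear V -> V}).
Local Notation dg := (fun k : 'I_m => U_(tagnat.sig1 k)%MM).

Lemma multideg1 (k : 'I_m) : multideg U_(k) = U_(tagnat.sig1 k)%MM :> 'X_{1..q}.
Proof.
apply/mnmP => p; rewrite mnmE mnm1E; case: (eqVneq (tagnat.sig1 k) p) => [e|ne].
  rewrite (bigD1 k) ?e //= mnm1E eqxx big1 // => j /andP[_ jk].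
  by rewrite mnm1E eq_sym (negbTE jk).
rewrite big1 // => j /eqP e; rewrite mnm1E; case: eqP => // kj.
by rewrite -kj in e; rewrite e eqxx in ne.
Qed.

Lemma mpolyX_multihomog (k : 'I_m) :
  is_multihomog ('X_k : mring A n) U_(tagnat.sig1 k)%MM.
Proof. by move=> j; rewrite msuppX inE => /eqP ->; apply: multideg1. Qed.

Lemma stable_act (Y : submod V) f x : stable t (enum 'I_m) Y -> Y x -> Y (act f x).
Proof.
move=> sY Yx; rewrite /act (mpolyE f) scaler_suml.
apply: (@submod_sum _ V) => j _.
rewrite -mul_mpolyC -scalerA; apply: (@submodZ _ V Y).
elim/mnm_ind: j => [|k j ih]; first by rewrite mpolyX0 scale1r.
by rewrite mpolyXD -scalerA; apply: sY; rewrite ?mem_enum.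
Qed.

Lemma fin_gen_generates : fin_gen M -> exists G : seq V,
  generates t (enum 'I_m) G (full_submod V).
Proof.
move=> [s hs]; exists s; split=> // Y sY GY x _; have [c ->] := hs x.
apply: (@submod_sum _ V) => i _; apply: stable_act => //; apply: GY.
exact: mem_nth.
Qed.

Definition restr_submod (U : submod M) : submod V.
Proof.
exists (fun x : V => U x).
- exact: submod0.
- by move=> x y; apply: submodD.
- by move=> a x; apply: (@submodZ _ M U).
Defined.

Lemma ideal_mul_rcons s g x : ideal_mul M (rcons s g) x <->
  exists y z, ideal_mul M s y /\ x = y + g *: z.
Proof.
split=> [[y ->]|[_ [z [[y ->] ->]]]].
  exists (\sum_(i < size s) s`_i *: y i), (y (size s)); split; first by exists y.
  rewrite size_rcons big_ord_recr /= nth_rcons ltnn eqxx; congr (_ + _).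
  by apply: eq_bigr => i _; rewrite nth_rcons ltn_ord.
exists (fun i => if i == size s then z else y i).
rewrite size_rcons big_ord_recr /= nth_rcons ltnn eqxx; congr (_ + _).
by apply: eq_bigr => i _; rewrite nth_rcons ltn_ord (ltn_eqF (ltn_ord i)).
Qed.

Hypothesis mgM : multigraded M.

Let Mc_span : forall x : V, exists (s : seq 'X_{1..q}) (c : 'X_{1..q} -> V),
  (forall d, Mc d (c d)) /\ x = \sum_(d <- s) c d.
Proof. by case: mgM. Qed.

Let Mc_indep : forall (s : seq 'X_{1..q}) (c : 'X_{1..q} -> V),
  uniq s -> (forall d, Mc d (c d)) -> \sum_(d <- s) c d = 0 ->
  forall d, d \in s -> c d = 0.
Proof. by case: mgM. Qed.

Let Mc_act f d e (x : V) : is_multihomog f e -> Mc d x -> Mc (e + d)%MM (act f x).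
Proof. by case: mgM => _ _; apply. Qed.

Lemma Mc_stable : fam_stable t dg Mc.
Proof. by move=> k d x; apply: Mc_act; apply: mpolyX_multihomog. Qed.

Lemma multigraded_noetherian : noetherian A -> fin_gen M ->
  forall W, fam_ssub W Mc -> fam_stable t dg W -> exists G, fam_gen t dg G W.
Proof.
move=> noeth /fin_gen_generates[G hG].
have nV := hilbert_basis (fun i j x => actC _ _ x) noeth hG.
exact: (fam_noetherian Mc_span Mc_indep nV).
Qed.

Local Notation pr := (proj Mc).

Lemma ideal_mul_proj s d (x : M) : (forall g, g \in s -> multihomog g) ->
  ideal_mul M s x -> ideal_mul M s (pr d (x : V)).
Proof.
elim/last_ind: s x => [|s g ih] x hs.
  move=> [y]; rewrite big_ord0 => ->; exists (fun=> 0); rewrite big_ord0.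
  exact: (linear0 (pr d)).
move=> /ideal_mul_rcons[y [z [Iy ->]]]; apply/ideal_mul_rcons.
have [e ge] : multihomog g by apply: hs; rewrite mem_rcons mem_head.
exists (pr d (y : V)), (if (e <= d)%MM then pr (d - e)%MM (z : V) else 0); split.
  by apply: ih => // h hh; apply: hs; rewrite mem_rcons inE hh orbT.
rewrite -[LHS]/(pr d ((y : V) + act g z)) linearD; congr (_ + _).
rewrite /= (proj_shift Mc_span Mc_indep (F := act g) (e := e)); last first.
  by move=> d' x'; apply: Mc_act.
by case: ifP => // _; rewrite scaler0.
Qed.

Definition ideal_part s d : submod V := cap_submod (restr_submod (ideal_mul M s)) (Mc d).

Lemma ideal_part_stable s : fam_stable t dg (ideal_part s).
Proof.
move=> k d x [Ix Mx]; split; last exact: Mc_stable.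
exact: (@submodZ _ M (ideal_mul M s)).
Qed.

Lemma ideal_part_ssub s : fam_ssub (ideal_part s) Mc.
Proof. by move=> d x []. Qed.

(** Follows by taking components of degree [e + d] in [y + g *: z]; it supplies the hypothesis [B'E]
    of the reduction step. *)
Lemma ideal_part_rcons s g e d : (forall h, h \in s -> multihomog h) ->
  is_multihomog g e -> ideal_part (rcons s g) (e + d)%MM =
  add_submod (img_submod (act g) (Mc d)) (ideal_part s (e + d)%MM).
Proof.
move=> hs ge; apply: submod_eq.
  move=> x [/= /ideal_mul_rcons[y [z [Iy xE]]] Mx].
  exists (act g (pr d (z : V))), (pr (e + d)%MM (y : V)); split.
  - by exists (pr d (z : V)) => //; apply: (proj_in Mc_span).
  - by split; [apply: ideal_mul_proj|apply: (proj_in Mc_span)].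
  rewrite -(proj_id Mc_span Mc_indep Mx) [x in LHS]xE.
  rewrite -[LHS]/(pr (e + d)%MM ((y : V) + act g z)) linearD addrC; congr (_ + _).
  rewrite /= (proj_shift Mc_span Mc_indep (F := act g) (e := e)); last first.
    by move=> d' x'; apply: Mc_act.
  by rewrite lem_addr [(e + d)%MM]addmC addmK.
apply: add_ssub => [_ [x Mx ->]|x [/= Ix Mx]]; split=> //=.
- by apply/ideal_mul_rcons; exists 0, x; rewrite add0r; split=> //; apply: submod0.
- exact: Mc_act.
- by apply/ideal_mul_rcons; exists x, 0; rewrite scaler0 addr0.
Qed.

Definition qpi_restr (U : submod M) (x : V) : restr (Defs.quot_type U) := Defs.qpi U x.
Fact qpi_restr_is_linear U : linear (qpi_restr U).
Proof.
by move=> a x y; rewrite /qpi_restr; apply: (linearP (Defs.qpi U) a%:MP (x : M) (y : M)).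
Qed.
HB.instance Definition _ U := GRing.isLinear.Build A V (restr (Defs.quot_type U)) *:%R
  (qpi_restr U) (qpi_restr_is_linear U).

Lemma len_quot_component (p : primeid A) s d :
  len p (zero_submod (component (mg_quot (ideal_mul M s)) d))
    (full_submod (component (mg_quot (ideal_mul M s)) d)) =
  len p (ideal_part s d) (Mc d).
Proof.
set U := ideal_mul M s.
transitivity (len p (zero_submod (restr (Defs.quot_type U))) (quot_comp U d)).
  by rewrite /len; congr xget; apply/funext => k; apply/propext; apply: is_len_submod_type.
have := len_iso p (qpi_restr U) (Mc d) (zero_submod (restr (Defs.quot_type U))).
rewrite (_ : cap_submod _ _ = ideal_part s d) => [->|].
  congr len; apply: submod_eq.
    by move=> _ [x [Mx ->]]; apply: ssub_addl; exists x.
  apply: add_ssub; last exact: zero_ssub.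
  by move=> _ [x Mx ->]; exists x.
by apply: submod_eq => x [h Mx]; split=> //; [apply: (qpi_eq0 U x).1|apply: (qpi_eq0 U x).2].
Qed.

(** Functionals on [M] restrict to its components and separate their points, so dimensions over the
    fraction field are lengths at the zero prime; torsion-freeness makes the initial torsion
    zero. *)
Lemma multigraded_zero_bounded (H : {mpoly rat[q]}) : projective V ->
  is_hilbert_poly M H -> bounded Mc (msize H) (ideal_part [::]).
Proof.
move=> projM hH.
have I0 d : ideal_part [::] d = zero_submod V.
  apply: submod_eq => [x [[y ->] _]|x ->]; last exact: submod0.
  by rewrite big_ord0.
have rk : eventually (fun d => exists2 k,
    is_len (zero_prime A) (zero_submod V) (Mc d) k & H.@[fun p => (d p)%:R] = k%:R).
  apply: eventually_imp hH => d [k [dimk Hk]]; exists k => //.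
  apply/is_len_submod_type; apply: is_dim_rank dimk => x phi0.
  apply: val_inj; rewrite [RHS](linear0 (submod_val _)); apply: (projective_separated projM).
  by move=> phi; apply: (phi0 (phi \o submod_val (Mc d))).
split.
- by apply: eventually_imp rk => d [k hk _]; rewrite I0; apply: is_len_fin hk.
- apply: evpoly_ext (evpoly_mpoly H); apply: eventually_imp rk => d [k hk ->].
  by rewrite I0 (len_eq hk).
move=> p _; apply: evpoly_ext (evpoly0 _ _); apply: eventually_all => d.
rewrite I0 (_ : torsion_part _ _ _ = zero_submod V) ?len_refl //.
apply: submod_eq => [x [_ [s s0]]|x ->]; last exact: submod0.
by rewrite I0 => /(projective_torsion_free projM s0).
Qed.

(** Each of the [msize H] elements lowers the bound by one. *)
Lemma filter_regular_bounded (f : seq (mring A n)) (H : {mpoly rat[q]}) :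
  (0 < q)%N -> noetherian A -> fin_gen M -> projective V ->
  is_hilbert_poly M H -> size f = msize H -> filter_regular_seq M f ->
  bounded Mc 0 (ideal_part f).
Proof.
move=> q0 noeth fgM projM hH szf reg.
suff h i : (i <= size f)%N -> bounded Mc (size f - i) (ideal_part (take i f)).
  by have := h (size f) (leqnn _); rewrite subnn take_size.
elim: i => [|i ih] lt.
  by rewrite subn0 take0 szf; apply: multigraded_zero_bounded.
have [[e fe] [d0 freg]] := reg i lt.
have hom g : g \in take i f -> multihomog g.
  move=> /(nthP 0)[j]; rewrite size_take lt => ji <-; rewrite nth_take //.
  by have [] := reg j (ltn_trans ji lt).
have := ih (ltnW lt); rewrite -(subnSK lt) (take_nth 0 lt).
apply: (@bounded_step _ _ _ _ t (fun k => tagnat.sig1 k) _ _ q0 noeth _ _ (act f`_i) e) => //.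
- by move=> i1 i2 x; apply: actC.
- exact: multigraded_noetherian.
- exact: Mc_stable.
- by move=> d x; apply: Mc_act.
- move=> d x [Ix Mx]; split; last exact: Mc_act.
  exact: (@submodZ _ M (ideal_mul M _)).
- exact: ideal_part_stable.
- exact: ideal_part_stable.
- move=> d x [Ix Mx]; split=> //; apply/ideal_mul_rcons.
  by exists x, 0; rewrite scaler0 addr0.
- exact: ideal_part_ssub.
- by move=> d; apply: ideal_part_rcons.
exists d0 => d dd x Mx [Ix _]; split=> //.
apply: (qpi_eq0 (ideal_mul M (take i f)) x).1.
apply: (freg d dd (Defs.qpi (ideal_mul M (take i f)) x)); first by exists x.
have <- := linearZ_LR (Defs.qpi (ideal_mul M (take i f))) f`_i (x : M).
exact: (qpi_eq0 (ideal_mul M (take i f)) _).2 Ix.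
Qed.

End Multigraded.

Lemma div_torsion (A : idomainType) (N : lmodType A) : torsion N ->
  div N = Some (\sum_(p \in [set: ht1prime A])
    << (mlength (loc_mod (val p) N))%:Z *g p >>).
Proof. by move=> tN; rewrite /div; case: (pselect (torsion N)). Qed.

Theorem proposition2p7 (A : idomainType) (q : nat) (n : 'I_q -> nat)
    (M : mgmod A n) (r : int) (f : seq (mring A n)) :
  (1 <= q)%N -> (forall p, (1 <= n p)%N) ->
  noetherian A ->
  multigraded M -> fin_gen M -> projective (restr M) ->
  rdim_eq M r ->
  (size f)%:Z = r + 1 -> filter_regular_seq M f ->
  exists nu0 : 'X_{1..q}, forall nu : 'X_{1..q}, (nu0 <= nu)%MM ->
    div (component (mg_quot (ideal_mul M f)) nu) =
      div (component (mg_quot (ideal_mul M f)) nu0) /\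
    div (component (mg_quot (ideal_mul M f)) nu0) <> div_zero A.
Proof.
move=> q0 _ noeth mgM fgM projM [H hH rE] szf reg.
(* [r + 1] is [msize H], also when [H = 0] and the sequence is empty. *)
have {}szf : size f = msize H by move: szf; rewrite rE subrK => -[].
have bnd := filter_regular_bounded mgM q0 noeth fgM projM hH szf reg.
have [nu0 [[a a0 aM] lenE]] := bounded0_eventually noeth
  (multigraded_noetherian mgM noeth fgM) (Mc_stable mgM) (ideal_part_stable mgM (s := f))
  (@ideal_part_ssub _ _ _ _ f) bnd.
exists nu0 => nu le.
have tors mu : (nu0 <= mu)%MM -> torsion (component (mg_quot (ideal_mul M f)) mu).
  move=> lemu; exists a => // z; apply: val_inj; rewrite [RHS](linear0 (submod_val _)).
  rewrite [LHS](linearZ_LR (submod_val _) a z) /=.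
  case: z => z /= /asboolP[x [Mx ->]].
  rewrite -[LHS](linearZ_LR (qpi_restr (ideal_mul M f)) a x).
  exact: (qpi_eq0 (ideal_mul M f) _).2 (aM mu lemu x Mx).1.
(* From [nu0] on the components are torsion, so both divisors have the form [Some], which differs
   from [div_zero A]; what remains is to compare lengths prime by prime. *)
rewrite (div_torsion (tors nu le)) (div_torsion (tors nu0 (lepm_refl _))).
split=> //; congr Some; apply: eq_fsbigr => p _; congr << (_ : int) *g p >>; congr Posz.
rewrite !mlength_loc_mod !len_quot_component; exact: lenE.
Qed.
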